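(* Let $n\ge 2$ and let $Z \subset \mathbb{P}^n$ be a set of at most $n+3$ points spanning $\mathbb{P}^n$. If $|Z| = n+3$, suppose that $Z$ is in linearly general position. Consider for an integer $k\ge 1$ the inequality \[ \widehat\alpha(I_Z) \ge \frac{\alpha(I_Z^{(k)})+n-1}{n+k-1}. \qquad ( * ) \] Then $( * )$ holds for every $k\ge 1$, unless $|Z| = n+3$ and $n$ is odd. If $|Z| = n+3$ and $n$ is odd, then $( * )$ holds whenever $k \ge \frac{(n^2+n+1)(n^2+2n-1)}{2(n+2)}$.
   Context: $R = K[x_0,\ldots,x_n]$ over an arbitrary field $K$, $\mathbb{P}^n$ is projective space over $K$. $I_Z\subset R$ is the homogeneous ideal of the finite point set $Z$, and $I_Z^{(k)} = \bigcap_{P\in Z} I_P^k$ its $k$-th symbolic power. For a homogeneous ideal $I\neq0$, $\alpha(I)=\min\{j : [I]_j\neq 0\}$. The Waldschmidt constant is $\widehat\alpha(I_Z) = \lim_{k\to\infty} \frac{\alpha(I_Z^{(k)})}{k}$ (the limit always exists). A finite set of points in $\mathbb{P}^n$ is in linearly general position if every subset of $r+1 \le n+1$ of its points spans an $r$-dimensional linear subspace. *)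

(* Defs.v *)
(* MathComp with multinomials and MathComp-Analysis; [mpoly] has to be imported
   before the analysis files, the other order makes their notations clash. *)
From mathcomp Require Import all_boot all_order all_algebra finmap.
From mathcomp Require Import mpoly.
From mathcomp Require Import boolp classical_sets reals topology normedtype.
From mathcomp Require Import sequences.

Set Implicit Arguments.
Unset Strict Implicit.
Unset Printing Implicit Defensive.

Import Order.TTheory GRing.Theory Num.Theory.
Import numFieldNormedType.Exports.

Local Open Scope classical_set_scope.
Local Open Scope ring_scope.

(* Points of P^n(K) are the lines through the origin of K^(n+1). *)
Definition pspace (K : fieldType) (n : nat) : Type :=
  {L : {vspace 'rV[K]_n.+1} | \dim L == 1%N}.

(* The linear subspace of P^n spanned by Z, as a subspace of K^(n+1); its
   projective dimension is one less than its [\dim]. *)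
Definition pspan (K : fieldType) (n : nat) (Z : {fset pspace K n}) :
    {vspace 'rV[K]_n.+1} :=
  (\sum_(P <- Z) val P)%VS.

Definition linearly_general (K : fieldType) (n : nat) (Z : {fset pspace K n}) :
    Prop :=
  forall (r : nat) (S : {fset pspace K n}),
    (r <= n)%N -> (S `<=` Z)%fset -> #|` S| = r.+1 -> \dim (pspan S) = r.+1.

Section Ideals.
Variable A : comNzRingType.
Implicit Types I J S : set A.

Definition ideal_gen S : set A :=
  [set f | exists s : seq (A * A),
    (forall ab, ab \in s -> S ab.2) /\ f = \sum_(ab <- s) ab.1 * ab.2].

Definition ideal_mul I J : set A := ideal_gen [set a * b | a in I & b in J].

Definition ideal_pow I (k : nat) : set A := iter k (ideal_mul I) setT.

End Ideals.

(* The homogeneous ideal I_Z.  Restricting to homogeneous generators matters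
   over a finite field, where a nonhomogeneous polynomial can vanish at every
   representative of a point. *)
Definition vanishing_ideal (K : fieldType) (n : nat) (Z : {fset pspace K n}) :
    set {mpoly K[n.+1]} :=
  ideal_gen [set f : {mpoly K[n.+1]} |
    (exists d : nat, f \is d.-homog) /\
    forall P, P \in Z ->
      forall v : 'rV[K]_n.+1, v \in val P -> v != 0 ->
        f.@[fun i => v ord0 i] = 0].

Definition symbolic_power (K : fieldType) (n : nat) (Z : {fset pspace K n})
    (k : nat) : set {mpoly K[n.+1]} :=
  \bigcap_(P in [set P | P \in Z]) ideal_pow (vanishing_ideal [fset P]%fset) k.

(* The minimum exists for every homogeneous ideal I != 0; otherwise the value
   is the default 0. *)
Definition alpha (K : fieldType) (n : nat) (I : set {mpoly K[n.+1]}) : nat :=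
  let degs := [set j : nat | exists f, [/\ I f, f \is j.-homog & f != 0]] in
  xget 0%N (degs `&` lbound degs).

Definition waldschmidt (R : realType) (K : fieldType) (n : nat)
    (Z : {fset pspace K n}) : R :=
  limn (fun k : nat => (alpha (symbolic_power Z k))%:R / k%:R : R).

Definition waldschmidt_bound (R : realType) (K : fieldType) (n : nat)
    (Z : {fset pspace K n}) (k : nat) : Prop :=
  ((alpha (symbolic_power Z k))%:R + n%:R - 1) / (n%:R + k%:R - 1)
    <= waldschmidt R Z.

(* Main.v *)
(* For suitable integers [p], [q], two bounds give the claim: a nonzero form of
   degree [d] vanishing to order [k] on [Z] has [(q + p) * k <= q * d], and
   there is such a form of degree [k + e] with [q * e <= p * (k + n - 1)].  Then
   the Waldschmidt constant is [(q + p) / q], and the second bound is exactly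
   the required inequality.

   Lower bounds: restrict the form to a rational curve of degree [q] through a
   generic point (over [Frac K[X_0, ..., X_n]]) that meets [Z] in [q + p]
   points, counted with multiplicity.
   Upper bounds: multiply forms of small degree.

   - [|Z| <= n + 2]: [Z] consists of the coordinate points and of the sum of
     those in a subset [S]; [p = 2], [q = 2 n + 1 - |S|], and hyperplanes
     suffice.
   - [|Z| = n + 3], [n = 2 m]: [p = 2], [q = n], using the equations of secant
     varieties of the rational normal curve through [Z], and cones over such.
   - [|Z| = n + 3], [n = 2 m + 1]: [p = 2 m + 3], [q = 2 m^2 + 4 m + 1].  The
     forms are the cones with vertex a point of [Z] over secant varieties, the
     vertex running cyclically through [Z].  The curve passes [m + 1] times
     through each point of [Z]; it is obtained from the Bezoutian of two
     generic polynomials of degree [m + 1]. *)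
Require Import Defs.
From mathcomp Require Import all_boot all_order all_algebra finmap.
From mathcomp Require Import mpoly.
From mathcomp Require Import boolp classical_sets reals topology normedtype.
From mathcomp Require Import sequences.
From mathcomp Require Import perm fraction zify ring.

Set Implicit Arguments.
Unset Strict Implicit.
Unset Printing Implicit Defensive.

Import Order.TTheory GRing.Theory Num.Theory.

Local Open Scope ring_scope.

(** * Powers of ideals and homogeneous polynomials *)

Section IdealPowers.
Variable A : comNzRingType.
Implicit Types (I S : set A).

Lemma ideal_gen_min S (J : A -> Prop) :
    J 0 -> (forall x y, J x -> J y -> J (x + y)) ->
    (forall a x, S x -> J (a * x)) ->
  forall x, ideal_gen S x -> J x.
Proof.
move=> J0 JD JM x [s [Ss ->]]; elim: s Ss => [|ab s IH] Ss.
  by rewrite big_nil.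
rewrite big_cons; apply: JD; first by apply/JM/Ss; rewrite mem_head.
by apply: IH => cd cds; apply: Ss; rewrite in_cons cds orbT.
Qed.

Lemma ideal_gen_sub S x : S x -> ideal_gen S x.
Proof.
move=> Sx; exists [:: (1, x)]; split; last by rewrite big_seq1 mul1r.
by move=> ab; rewrite inE => /eqP ->.
Qed.

Lemma ideal_gen0 S : ideal_gen S 0.
Proof. by exists [::]; split=> //; rewrite big_nil. Qed.

Lemma ideal_genD S x y : ideal_gen S x -> ideal_gen S y -> ideal_gen S (x + y).
Proof.
move=> [s [Ss ->]] [t [St ->]]; exists (s ++ t); rewrite big_cat; split=> //.
by move=> ab; rewrite mem_cat => /orP[/Ss|/St].
Qed.

Lemma ideal_genM S a x : ideal_gen S x -> ideal_gen S (a * x).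
Proof.
move=> [s [Ss ->]]; exists [seq (a * b.1, b.2) | b <- s]; split.
  by move=> _ /mapP[b bs ->] /=; apply: Ss.
by rewrite big_map mulr_sumr; apply: eq_bigr => b _; rewrite mulrA.
Qed.

Lemma ideal_pow0 I k : ideal_pow I k 0.
Proof. by case: k => [|k] //=; apply: ideal_gen0. Qed.

Lemma ideal_powD I k x y :
  ideal_pow I k x -> ideal_pow I k y -> ideal_pow I k (x + y).
Proof. by case: k => [|k] //=; apply: ideal_genD. Qed.

Lemma ideal_powMl I k a x : ideal_pow I k x -> ideal_pow I k (a * x).
Proof. by case: k => [|k] //=; apply: ideal_genM. Qed.

Lemma ideal_pow_sum I k (J : Type) (r : seq J) (P : pred J) (F : J -> A) :
  (forall i, P i -> ideal_pow I k (F i)) ->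
  ideal_pow I k (\sum_(i <- r | P i) F i).
Proof.
by move=> IF; elim/big_ind: _ => // [|x y];
  [apply: ideal_pow0|apply: ideal_powD].
Qed.

Lemma ideal_pow1 I x : I x -> ideal_pow I 1 x.
Proof. by move=> Ix; apply: ideal_gen_sub; exists x => //; exists 1;
  rewrite ?mulr1. Qed.

Lemma ideal_powM I j k x y :
  ideal_pow I j x -> ideal_pow I k y -> ideal_pow I (j + k) (x * y).
Proof.
elim: j x => [|j IH] x /= Ix Iy; first exact: ideal_powMl.
apply: (ideal_gen_min (J := fun x => ideal_pow I (j.+1 + k) (x * y))) Ix.
- by rewrite mul0r; apply: ideal_pow0.
- by move=> u v; rewrite mulrDl; apply: ideal_powD.
move=> a _ [u Iu [v Iv <-]]; rewrite -!mulrA; apply: ideal_powMl => /=.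
by apply: ideal_gen_sub; exists u => //; exists (v * y) => //; apply: IH.
Qed.

Lemma ideal_powW I j k x : (j <= k)%N -> ideal_pow I k x -> ideal_pow I j x.
Proof.
move=> /subnK <-; elim: (k - j)%N => // i IH Ix; apply: IH.
apply: ideal_gen_min Ix; [exact: ideal_pow0|by move=> ? ?; apply: ideal_powD|].
by move=> a _ [u _ [v Iv <-]]; rewrite mulrA; apply: ideal_powMl.
Qed.

Lemma ideal_pow_prod I (J : Type) (r : seq J) (P : pred J) (F : J -> A)
    (k : J -> nat) :
  (forall i, P i -> ideal_pow I (k i) (F i)) ->
  ideal_pow I (\sum_(i <- r | P i) k i) (\prod_(i <- r | P i) F i).
Proof.
move=> IF; elim/big_rec2: _ => //= i y x Pi Iy.
exact/ideal_powM/Iy/IF.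
Qed.

(** Transfers orders of vanishing to a curve: [phi] plays the role of the pullback to the curve, and
    [c] of the divisor where the curve meets the zero set of [I]. *)
Lemma ideal_pow_dvdp (L : fieldType) (phi : {rmorphism A -> {poly L}}) I c k :
    (forall x, I x -> c %| phi x) ->
  forall x, ideal_pow I k x -> c ^+ k %| phi x.
Proof.
move=> Ic; elim: k => [|k IH] x /=; first by rewrite expr0 dvd1p.
apply: (ideal_gen_min (J := fun x => c ^+ k.+1 %| phi x)).
- by rewrite raddf0 dvdp0.
- by move=> u v cu cv; rewrite rmorphD dvdp_add.
move=> a _ [u Iu [v Iv <-]]; rewrite !rmorphM exprS dvdp_mull //.
by apply: dvdp_mul; [apply: Ic|apply: IH].
Qed.

End IdealPowers.

(** Degrees are formal: the sizes are only bounded, and the coefficient at the formal degree may be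
    zero. This is the bookkeeping needed to evaluate a parametrized curve at infinity. *)
Lemma coefM_top (L : fieldType) (p q : {poly L}) a b :
    (size p <= a.+1)%N -> (size q <= b.+1)%N ->
  (size (p * q)%R <= (a + b).+1)%N /\ (p * q)`_(a + b) = p`_a * q`_b.
Proof.
move=> sp sq; split.
  apply: leq_trans (size_polyMleq _ _) _.
  by rewrite -subn1 leq_subLR; apply: leq_trans (leq_add sp sq) _;
    rewrite addSn addnS add1n.
rewrite coefM (bigD1 (inord a)) //= inordK ?leq_addr // ?ltnS ?leq_addr //
  addKn.
rewrite big1 ?addr0 // => i.
rewrite -val_eqE /= inordK ?ltnS ?leq_addr // neq_ltn => /orP[ia|ai].
  rewrite [q`__]nth_default ?mulr0 //; apply: leq_trans sq _.
  by rewrite ltn_subRL ltn_add2r.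
by rewrite [p`_i]nth_default ?mul0r //; apply: leq_trans sp _.
Qed.

Lemma coef_prod_top (L : fieldType) (J : Type) (r : seq J) (P : pred J)
    (F : J -> {poly L}) (k : J -> nat) :
    (forall i, P i -> (size (F i) <= (k i).+1)%N) ->
  (size (\prod_(i <- r | P i) F i)%R <= (\sum_(i <- r | P i) k i).+1)%N /\
  (\prod_(i <- r | P i) F i)`_(\sum_(i <- r | P i) k i) =
    \prod_(i <- r | P i) (F i)`_(k i).
Proof.
move=> sF; elim/big_rec3: _ => [|i x y z Pi [sx <-]].
  by rewrite size_poly1 coef1.
by have [] := coefM_top (sF i Pi) sx.
Qed.

Lemma coef_exp_top (L : fieldType) (p : {poly L}) a j :
    (size p <= a.+1)%N ->
  (size (p ^+ j)%R <= (j * a).+1)%N /\ (p ^+ j)`_(j * a) = p`_a ^+ j.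
Proof.
move=> sp; elim: j => [|j [IHs IHc]]; first by rewrite !expr0 size_poly1 coef1.
by rewrite exprS mulSn exprS; have [-> ->] := coefM_top sp IHs; rewrite IHc.
Qed.

(** * Substitution in homogeneous polynomials *)

Section Homogeneous.
Variables (K : fieldType) (n : nat).
Implicit Types f g : {mpoly K[n]}.

Lemma mmap_homogZ (S : comNzRingType) (phi : {rmorphism K -> S}) (h : 'I_n -> S)
    (c : S) d f : f \is d.-homog ->
  mmap phi (fun i => c * h i) f = c ^+ d * mmap phi h f.
Proof.
move=> /dhomogP hf; rewrite /mmap mulr_sumr [LHS]big_seq [RHS]big_seq.
apply: eq_bigr => m /hf dm; rewrite mulrCA; congr (_ * _).
rewrite /mmap1 -dm /= mdegE -prodrXr -big_split /=.
by apply: eq_bigr => i _; rewrite exprMn.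
Qed.

Lemma meval_homogZ (v : 'I_n -> K) c d f : f \is d.-homog ->
  f.@[fun i => c * v i] = c ^+ d * f.@[v].
Proof. exact: mmap_homogZ. Qed.

Lemma mmap_dvdp (L : fieldType) (phi : {rmorphism K -> {poly L}})
    (h h' : 'I_n -> {poly L}) c f :
  (forall i, c %| h i - h' i) -> c %| mmap phi h f - mmap phi h' f.
Proof.
move=> ch; rewrite /mmap -sumrB.
elim/big_ind: _ => [|x y cx cy|m _]; [exact: dvdp0|exact: dvdp_add|].
rewrite -mulrBr dvdp_mull // /mmap1.
elim/big_ind2: _ => [|x' x y' y cx cy|i _]; first by rewrite subrr dvdp0.
  have -> : x * y - x' * y' = (x - x') * y + x' * (y - y').
    by rewrite mulrBl mulrBr addrA subrK.
  by apply: dvdp_add; [apply: dvdp_mulr|apply: dvdp_mull].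
elim: (m i) => [|j IH]; first by rewrite subrr dvdp0.
have -> : h i ^+ j.+1 - h' i ^+ j.+1 =
    (h i - h' i) * h i ^+ j + h' i * (h i ^+ j - h' i ^+ j).
  by rewrite mulrBl mulrBr -!exprS addrA subrK.
by apply: dvdp_add; [apply: dvdp_mulr|apply: dvdp_mull].
Qed.

(** Evaluation at infinity: the coefficients of degree [e] form the point of the curve [h] at
    infinity, and the top coefficient of the restricted form is the value there. *)
Lemma mmap_top (L : fieldType) (phi : {rmorphism K -> L}) (h : 'I_n -> {poly L})
    e d f :
    (forall i, (size (h i) <= e.+1)%N) -> f \is d.-homog ->
  let p := mmap (polyC \o phi) h f in
  (size p <= (e * d).+1)%N /\ p`_(e * d) = mmap phi (fun i => (h i)`_e) f.
Proof.
move=> sh /dhomogP hf /=.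
have top m : m \in msupp f ->
    (size (mmap1 h m) <= (e * d).+1)%N /\
    (mmap1 h m)`_(e * d) = mmap1 (fun i => (h i)`_e) m.
  move=> /hf <-; rewrite /mmap1 /= mulnC mdegE big_distrl /=.
  have [i _|s1 c1] := coef_prod_top (index_enum 'I_n) (P := xpredT)
      (F := fun i => h i ^+ m i) (k := fun i => (m i * e)%N).
    by have [] := coef_exp_top (m i) (sh i).
  by split=> //; rewrite c1; apply: eq_bigr => i _;
    have [] := coef_exp_top (m i) (sh i).
rewrite /mmap big_seq; split.
  elim/big_ind: _ => [|x y sx sy|m /top[sm _]]; first by rewrite size_poly0.
    by apply: leq_trans (size_polyD _ _) _; rewrite geq_max sx sy.
  by rewrite mul_polyC; apply: leq_trans (size_scale_leq _ _) sm.
rewrite coef_sum [RHS]big_seq; apply: eq_bigr => m /top[_ cm].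
by rewrite coefCM cm.
Qed.

End Homogeneous.

(** * Points, initial degrees and the limit *)
Import numFieldNormedType.Exports.

Section Points.
Variables (K : fieldType) (n : nat).
Implicit Types (P : pspace K n) (Z : {fset pspace K n}) (v : 'rV[K]_n.+1).

Lemma mmap_rmorph (S T : comNzRingType) (phi : {rmorphism K -> S})
    (psi : {rmorphism S -> T}) (h : 'I_n.+1 -> S) f :
  psi (mmap phi h f) = mmap (psi \o phi) (psi \o h) f.
Proof.
rewrite /mmap rmorph_sum; apply: eq_bigr => m _.
rewrite rmorphM rmorph_prod; congr (_ * _).
by apply: eq_bigr => i _; rewrite rmorphXn.
Qed.

Lemma vanishing_ideal_homog P v d f :
    val P = <[v]>%VS -> f \is d.-homog -> f.@[fun i => v ord0 i] = 0 ->
  vanishing_ideal [fset P]%fset f.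
Proof.
move=> Pv fd fv; apply: ideal_gen_sub; split; first by exists d.
move=> Q; rewrite inE => /eqP -> w; rewrite Pv => /vlineP[c ->] _.
rewrite (meval_eq _ (v2 := fun i => c * v ord0 i));
  last by move=> i; rewrite mxE.
by rewrite (meval_homogZ _ _ fd) fv mulr0.
Qed.

(* The germ [h] passes through P along the divisor [c]. *)
Lemma vanishing_ideal_pow_dvdp (L : fieldType) (phi : {rmorphism K -> {poly L}})
    (h : 'I_n.+1 -> {poly L}) P v c mu lam k f :
    val P = <[v]>%VS -> v != 0 -> coprimep c mu ->
    (forall i, c %| mu * h i - lam * phi (v ord0 i)) ->
    ideal_pow (vanishing_ideal [fset P]%fset) k f ->
  c ^+ k %| mmap phi h f.
Proof.
move=> Pv v0 cmu ch; apply: ideal_pow_dvdp => {f}.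
apply: (ideal_gen_min (J := fun f => c %| mmap phi h f)).
- by rewrite raddf0 dvdp0.
- by move=> x y cx cy; rewrite raddfD dvdp_add.
move=> a f [[d fd] /(_ P)]; rewrite inE eqxx => /(_ isT v).
rewrite Pv memv_line v0 => /(_ isT isT) fv.
(* As [mu] is coprime to [c], divisibility may be tested after multiplying by [mu ^+ d]; by
   homogeneity this replaces [h] by [mu * h], which is congruent to a multiple of [v]. *)
rewrite rmorphM dvdp_mull // -(@Gauss_dvdpr _ _ (mu ^+ d)) ?coprimep_expr //.
rewrite -(mmap_homogZ _ _ _ fd).
rewrite -(@dvdp_subl _ _ _ (mmap phi (fun i => lam * phi (v ord0 i)) f)).
  exact: mmap_dvdp.
rewrite (mmap_homogZ _ _ _ fd) -[mmap _ _ _]/(mmap (phi \o idfun) (phi \o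
  (fun i => v ord0 i)) f).
by rewrite -mmap_rmorph [mmap _ _ _]fv rmorph0 mulr0 dvdp0.
Qed.

(** A nonzero form in [I] makes the set of degrees inhabited, so [xget] returns a genuine minimum
    and not its default value. *)
Lemma alphaP (I : set {mpoly K[n.+1]}) d f :
    I f -> f \is d.-homog -> f != 0 ->
  (alpha I <= d)%N /\ exists g, [/\ I g, g \is (alpha I).-homog & g != 0].
Proof.
move=> If fd f0; rewrite /alpha; set degs := (X in (X `&` _)%classic).
have Id : degs d by exists f.
have ex : exists m, `[< degs m >] by exists d; apply/asboolP.
have [|[f' [? ? ?]] lb] := @xgetPex _ 0%N (degs `&` lbound degs)%classic.
  case: (ex_minnP ex) => m /asboolP Im min; exists m; split=> // j Ij.
  exact/min/asboolP.
by split; [apply: lb | exists f'].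
Qed.

Lemma waldschmidt_boundP (R : realType) Z (p q : nat) :
    (0 < q)%N ->
    (forall k d f, symbolic_power Z k f -> f \is d.-homog -> f != 0 ->
       ((q + p) * k <= q * d)%N) ->
    (forall k, (0 < k)%N -> exists e f,
       [/\ symbolic_power Z k f, f \is (k + e).-homog, f != 0
         & (q * e <= p * (k.-1 + n))%N]) ->
  forall k, (0 < k)%N -> waldschmidt_bound R Z k.
Proof.
move=> q0 lower upper.
pose a k := alpha (symbolic_power Z k).
have lo k : (0 < k)%N -> ((q + p) * k <= q * a k)%N.
  move=> /upper[e [f [If fd f0 _]]].
  by have [_ [g [Ig gd g0]]] := alphaP If fd f0; apply: lower gd g0.
have up k : (0 < k)%N -> (q * a k <= q * k + p * (k.-1 + n))%N.
  move=> /upper[e [f [If fd f0 le]]].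
  have [ad _] := alphaP If fd f0.
  by rewrite (leq_trans (leq_mul (leqnn q) ad)) // mulnDr leq_add2l.
have q0R : 0 < q%:R :> R by rewrite ltr0n.
(* The quotient [a k / k] is squeezed between [(q + p) / q] and the same plus a constant over [k].
   Shifting the sequence by one avoids [k = 0] and turns the error into a multiple of [harmonic]. *)
have lim : waldschmidt R Z = (q + p)%:R / q%:R.
  apply/cvg_lim => //; rewrite -cvg_shiftS /=.
  apply: (@squeeze_cvgr _ _ _ _ (fun=> (q + p)%:R / q%:R)
    (fun k => (q + p)%:R / q%:R + (p * n)%:R / q%:R * harmonic k)).
  - near=> k; rewrite /harmonic /=; apply/andP; split.
      by rewrite ler_pdivrMr // mulrAC ler_pdivlMr // -!natrM ler_nat [(a _ *
        q)%N]mulnC lo.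
    rewrite ler_pdivrMr // mulrDl divfK ?pnatr_eq0 // mulrAC -mulrDl.
    rewrite ler_pdivlMr // -!natrM -natrD ler_nat [(a _ * q)%N]mulnC.
    by apply: leq_trans (up _ _) _ => //=; lia.
  - exact: cvg_cst.
  have := cvgD (cvg_cst ((q + p)%:R / q%:R : R))
    (cvgM (cvg_cst ((p * n)%:R / q%:R : R)) (@cvg_harmonic R)).
  by rewrite mulr0 addr0; apply.
move=> k k0; rewrite /waldschmidt_bound lim.
have nk : n%:R + k%:R - 1 = (k.-1 + n)%:R :> R.
  by rewrite -{1}(prednK k0) natrD [k.-1.+1%:R]mulrSr addrA addrK addrC.
(* If [k.-1 + n = 0], the left side is [0], since the inverse of [0] is [0]. *)
rewrite nk; case: (posnP (k.-1 + n)) => [->|kn].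
  by rewrite invr0 mulr0 divr_ge0 ?ler0n.
rewrite ler_pdivrMr ?ltr0n // mulrAC ler_pdivlMr //.
have -> : (alpha (symbolic_power Z k))%:R + n%:R - 1 = (a k + n)%:R - 1 :> R.
  by rewrite natrD.
rewrite mulrBl mul1r lerBlDr -!natrM -natrD ler_nat.
by have := up k k0; case: k {lo up nk kn} k0 => //= k _; lia.
Unshelve. all: by end_near. Qed.

End Points.

(** * Rational curves through a generic point *)

Lemma mmap_eq (K S : nzRingType) n (phi psi : K -> S) (h h' : 'I_n -> S) f :
  phi =1 psi -> h =1 h' -> mmap phi h f = mmap psi h' f.
Proof.
move=> e1 e2; rewrite /mmap; apply: eq_bigr => m _; rewrite e1; congr (_ * _).
by apply: eq_bigr => i _; rewrite e2.
Qed.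

Lemma mmap_idX (K : comNzRingType) n (f : {mpoly K[n]}) :
  mmap (@mpolyC n K) (fun i => 'X_i) f = f.
Proof.
rewrite [RHS]mpolyE /mmap; apply: eq_bigr => m _.
by rewrite mmap1_id mul_mpolyC.
Qed.

Lemma prod_coprime_dvdp (L : fieldType) (I : finType) (F : I -> {poly L}) g :
    (forall i j, i != j -> coprimep (F i) (F j)) ->
  (forall i, F i %| g) -> \prod_i F i %| g.
Proof.
move=> coF dF; have := index_enum_uniq I.
elim: (index_enum I) => [|i r IH] /=; first by rewrite big_nil dvd1p.
case/andP=> ir /IH dr; rewrite big_cons Gauss_dvdp ?dF //.
rewrite big_seq; elim/big_ind: _ => [|x y cx cy|j jr]; first exact: coprimep1.
  by rewrite coprimepMr cx.
by apply: coF; apply: contraNneq ir => ->.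
Qed.

Section Curve.
Variables (K : fieldType) (n : nat) (B : 'M[K]_n.+1).
Variables (L : fieldType) (phi : {rmorphism K -> L}) (w : 'I_n.+1 -> L).
Variables (num den : 'I_n.+1 -> {poly L}) (a : 'I_n.+1 -> nat).

(** In the frame given by the rows of [B], the curve has coordinates [num i / den i]; clearing
    denominators makes it polynomial. *)
Definition curve_coord i := num i * \prod_(j | j != i) den j.
Definition curve j := \sum_i curve_coord i * (phi (B i j))%:P.

Lemma curve_dvdp_coord P (x : 'rV[K]_n.+1) c mu lam k f :
    B \in unitmx -> val P = <[x *m B]>%VS -> x != 0 -> coprimep c mu ->
    (forall i, c %| mu * curve_coord i - lam * (phi (x ord0 i))%:P) ->
    ideal_pow (vanishing_ideal [fset P]%fset) k f ->
  c ^+ k %| mmap (polyC \o phi) curve f.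
Proof.
move=> Bu Px x0 cmu cc; apply: (vanishing_ideal_pow_dvdp (lam := lam) Px _ cmu).
  by apply: contraNneq x0 => xB; rewrite -(mulmxK Bu x) xB mul0mx.
move=> j; rewrite /curve /= mxE mulr_sumr !rmorph_sum mulr_sumr -sumrB.
elim/big_ind: _ => [|u v cu cv|i _]; first exact: dvdp0.
  exact: dvdp_add.
by rewrite !rmorphM /= [mu * _]mulrA [lam * _]mulrA -mulrBl; apply: dvdp_mulr;
  exact: cc.
Qed.

Lemma curve_dvdp P (x : 'rV[K]_n.+1) c mu lam k f :
    B \in unitmx -> val P = <[x *m B]>%VS -> x != 0 -> coprimep c mu ->
    (forall i, c %| mu * num i - lam * (phi (x ord0 i))%:P * den i) ->
    ideal_pow (vanishing_ideal [fset P]%fset) k f ->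
  c ^+ k %| mmap (polyC \o phi) curve f.
Proof.
move=> Bu Px x0 cmu cc.
apply: (curve_dvdp_coord (lam := lam * \prod_i den i) Bu Px x0 cmu) => i.
rewrite /curve_coord [\prod_i den i](bigD1 i) //=; set D := \prod_(_ | _) _.
have -> : mu * (num i * D) - lam * (den i * D) * (phi (x ord0 i))%:P =
  (mu * num i - lam * (phi (x ord0 i))%:P * den i) * D by ring.
exact/dvdp_mulr/cc.
Qed.

(** Modulo [den i] every cleared coordinate but the [i]-th vanishes, because it contains [den i] as
    a factor. *)
Lemma curve_dvdp_vertex P i k f :
    B \in unitmx -> val P = <[delta_mx ord0 i *m B]>%VS ->
    ideal_pow (vanishing_ideal [fset P]%fset) k f ->
  den i ^+ k %| mmap (polyC \o phi) curve f.
Proof.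
move=> Bu Px; apply: (curve_dvdp_coord (mu := 1) (lam := curve_coord i) Bu Px).
- by apply/eqP => /matrixP/(_ ord0 i)/eqP; rewrite !mxE !eqxx oner_eq0.
- exact: coprimep1.
move=> j; rewrite mul1r mxE eqxx /=; have [->|ji] := eqVneq j i.
  by rewrite rmorph1 mulr1 subrr dvdp0.
rewrite rmorph0 mulr0 subr0 /curve_coord (bigD1 i) 1?eq_sym //=.
by rewrite dvdp_mull // dvdp_mulr.
Qed.

(** Bezout on the curve: the restriction of [f] is nonzero because its top coefficient is the value
    of a nonzero form at the generic point [w]. It is divisible by the [k]-th power of [C] and of
    all [den i], and comparing degrees gives the bound. *)
Lemma curve_degree C d k f :
    B \in unitmx -> (forall g, g != 0 -> mmap phi w g != 0) ->
    (forall i, den i \is monic) -> (forall i, size (den i) = (a i).+2) ->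
    (forall i, size (num i) <= (a i).+1)%N ->
    (forall i, (num i)`_(a i) = w i) ->
    (forall i j, i != j -> coprimep (den i) (den j)) ->
    C \is monic -> (forall i, coprimep C (den i)) ->
    f \is d.-homog -> f != 0 ->
    (forall i, den i ^+ k %| mmap (polyC \o phi) curve f) ->
    C ^+ k %| mmap (polyC \o phi) curve f ->
  (((size C).-1 + \sum_i (a i).+1) * k <= (\sum_i (a i).+1).-1 * d)%N.
Proof.
move=> Bu wP denm dens nums numc codd Cm coC fd f0 ddvd Cdvd.
(* [N] is the degree of the product of the denominators. Each numerator has formal degree one less
   than its denominator, so the curve has degree [N - 1]. *)
set N := \sum_i _; pose e := N.-1.
have Ne : N = e.+1 by rewrite /e /N big_ord_recl.
have topd (P : pred 'I_n.+1) :
    (size (\prod_(j | P j) den j)%R <= (\sum_(j | P j) (a j).+1).+1)%N /\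
    (\prod_(j | P j) den j)`_(\sum_(j | P j) (a j).+1) = 1.
  have [i _|s1 c1] := coef_prod_top (index_enum 'I_n.+1) (P := P)
    (F := den) (k := fun i => (a i).+1); first by rewrite dens.
  split=> //; rewrite c1 big1 // => i _.
  by have /monicP := denm i; rewrite lead_coefE dens.
have topc i : (size (curve_coord i) <= e.+1)%N /\ (curve_coord i)`_e = w i.
  have [s1 c1] := topd (fun j => j != i).
  have -> : e = (a i + \sum_(j | j != i) (a j).+1)%N.
    by rewrite /e /N (bigD1 i).
  by have [s2 c2] := coefM_top (nums i) s1; split=> //;
    rewrite c2 c1 numc mulr1.
have sh j : (size (curve j) <= e.+1)%N.
  rewrite /curve; elim/big_ind: _ => [|x y sx sy|i _];
    first by rewrite size_poly0.
    by apply: leq_trans (size_polyD _ _) _; rewrite geq_max sx sy.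
  by rewrite mulrC mul_polyC (leq_trans (size_scale_leq _ _)) //;
    have [] := topc i.
have [sG cG] := mmap_top phi sh fd.
set G := mmap (polyC \o phi) curve f in ddvd Cdvd sG cG.
have G0 : G != 0.
  suff: G`_(e * d) != 0 by apply: contraNneq => ->; rewrite coef0.
  (* The linear substitution with matrix [M]. The point at infinity is [w] moved by [B], so [f] is
     evaluated there as [f] after [hB B], which is nonzero since [hB (invmx B)] undoes it. *)
  pose hB (M : 'M[K]_n.+1) j : {mpoly K[n.+1]} := \sum_i M i j *: 'X_i.
  rewrite cG; have -> : mmap phi (fun j => (curve j)`_e) f =
      mmap phi w (mmap (@mpolyC _ _) (hB B) f).
    rewrite mmap_rmorph; apply: mmap_eq => [c|j] /=; first by rewrite mmapC.
    rewrite /hB /curve coef_sum raddf_sum /=; apply: eq_bigr => i _.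
    by rewrite mmapZ mmapX mmap1U mulrC mul_polyC coefZ; have [_ ->] := topc i.
  apply: wP; apply: contraNneq f0 => fB.
  have := mmap_rmorph (@mpolyC n.+1 K) (mmap (@mpolyC _ _) (hB (invmx B)))
    (hB B) f.
  rewrite fB raddf0 => /esym;
    rewrite (mmap_eq (psi := @mpolyC _ _) (h' := fun i => 'X_i)).
  - by rewrite mmap_idX => ->.
  - by move=> c /=; rewrite mmapC.
  move=> j /=; rewrite /hB raddf_sum /=.
  under eq_bigr do rewrite mmapZ mmapX mmap1U mulr_sumr.
  rewrite exchange_big /= (bigD1 j) //= [X in _ + X]big1 ?addr0.
    transitivity (((invmx B *m B) j j) *: 'X_j : {mpoly K[n.+1]}).
      rewrite mxE scaler_suml; apply: eq_bigr => i _.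
      by rewrite mul_mpolyC scalerA mulrC.
    by rewrite mulVmx // mxE eqxx scale1r.
  move=> i ij; transitivity (((invmx B *m B) i j) *: 'X_i : {mpoly K[n.+1]}).
    rewrite mxE scaler_suml; apply: eq_bigr => l _.
    by rewrite mul_mpolyC scalerA mulrC.
  by rewrite mulVmx // mxE (negbTE ij) scale0r.
have dvd : (C * \prod_i den i) ^+ k %| G.
  rewrite exprMn Gauss_dvdp.
    rewrite Cdvd /= -prodrXl; apply: prod_coprime_dvdp => // i j ij.
    by rewrite coprimep_expl // coprimep_expr // codd.
  rewrite coprimep_expl // coprimep_expr //.
  by elim/big_ind: _ => [|x y cx cy|i _]; rewrite ?coprimep1 ?coprimepMr ?cx.
have := leq_trans (dvdp_leq G0 dvd) sG.
have Dm : \prod_i den i \is monic by apply: monic_prod => i _; apply: denm.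
have CDm : C * \prod_i den i \is monic by rewrite monicMl.
have sD : size (\prod_i den i) = N.+1.
  have [s1 c1] := topd xpredT; apply/eqP; rewrite eqn_leq s1 ltnNge.
  by apply/negP => /(nth_default 0)/eqP; rewrite c1 oner_eq0.
rewrite -[X in (_ <= X)%N -> _]/((e * d).+1) => le.
have : ((size ((C * \prod_i den i) ^+ k)%R).-1 <= e * d)%N by case: (size _) le.
rewrite size_exp size_monicM ?monic_neq0 // sD addnS /=.
by rewrite -{1}(prednK (n := size C)) // size_poly_gt0 monic_neq0.
Qed.

End Curve.

(** * The generic point *)

Section GenericPoint.
Variables (K : fieldType) (n : nat).

Definition genericField : fieldType := {fraction {mpoly K[n.+1]}}.
Definition genericC : {rmorphism K -> genericField} :=
  (@tofrac {mpoly K[n.+1]}) \o (@mpolyC n.+1 K).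
Definition genericX (i : 'I_n.+1) : genericField := tofrac 'X_i.

Lemma generic_mmap g : mmap genericC genericX g = tofrac g.
Proof.
rewrite -[g in RHS]mmap_idX mmap_rmorph.
by apply: mmap_eq.
Qed.

(** Open conditions on the generic point are checked by specializing it to a single point with
    coordinates in [K], which works over finite fields as well. *)
Lemma tofrac_neq0 (g : {mpoly K[n.+1]}) v : g.@[v] != 0 -> tofrac g != 0.
Proof. by rewrite tofrac_eq0; apply: contraNneq => ->; rewrite meval0. Qed.

Lemma generic_mmap_neq0 g : g != 0 -> mmap genericC genericX g != 0.
Proof. by rewrite generic_mmap tofrac_eq0. Qed.

Lemma genericX_neq0 i : genericX i != 0.
Proof.
by apply: (@tofrac_neq0 _ (fun=> 1)); rewrite mevalXU oner_eq0.
Qed.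

Lemma genericX_inj i j : i != j -> genericX i - genericX j != 0.
Proof.
move=> ij; rewrite -tofracB; apply: (@tofrac_neq0 _ (fun l => (l == i)%:R)).
by rewrite mevalB !mevalXU eqxx [j == i]eq_sym (negbTE ij) subr0 oner_eq0.
Qed.

Lemma genericX1_neq0 i : genericX i + 1 != 0.
Proof.
rewrite -tofrac1 -tofracD; apply: (@tofrac_neq0 _ (fun=> 0)).
by rewrite mevalD meval1 mevalXU add0r oner_eq0.
Qed.

Lemma genericX1_neqX i j : genericX i + 1 - genericX j != 0.
Proof.
rewrite -tofrac1 -tofracD -tofracB; apply: (@tofrac_neq0 _ (fun=> 0)).
by rewrite mevalB mevalD meval1 !mevalXU add0r subr0 oner_eq0.
Qed.

End GenericPoint.

(** * Lower bound for a frame and a sum of some of its vertices *)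

Section SubFrame.
Variables (K : fieldType) (n : nat) (B : 'M[K]_n.+1) (Z : {fset pspace K n}).
Variable S : {set 'I_n.+1}.
Hypotheses (Bu : B \in unitmx) (S0 : (0 < #|S|)%N).

Definition set_row : 'rV[K]_n.+1 := \row_i (i \in S)%:R.

Lemma set_row_neq0 : set_row != 0.
Proof.
case/card_gt0P: S0 => i iS; apply/eqP => /matrixP/(_ ord0 i)/eqP.
by rewrite !mxE iS oner_eq0.
Qed.

(* The curve has coordinates [w i / (t - w i)] on [S] and
   [w i * t / ((t - w i) * (t - w i - 1))] off [S]: it passes through the
   generic point [w] at infinity, through [set_row] at 0, once through the
   vertices in [S] and twice through the others. *)
Lemma subframe_curve (L : fieldType) (phi : {rmorphism K -> L})
  (w : 'I_n.+1 -> L)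
    k d f :
    (forall g, g != 0 -> mmap phi w g != 0) ->
    (forall i, w i != 0) -> (forall i j, i != j -> w i - w j != 0) ->
    (forall i, w i + 1 != 0) -> (forall i j, w i + 1 - w j != 0) ->
    (forall i, exists2 P, P \in Z & val P = <[delta_mx ord0 i *m B]>%VS) ->
    (exists2 P, P \in Z & val P = <[set_row *m B]>%VS) ->
    symbolic_power Z k f -> f \is d.-homog -> f != 0 ->
  ((2 * n + 1 - #|S| + 2) * k <= (2 * n + 1 - #|S|) * d)%N.
Proof.
move=> wP w0 wI w1 w1X Ze [Q QZ Qv] Zf fd f0.
pose num i := if i \in S then (w i)%:P else w i *: 'X.
pose den i := if i \in S then 'X - (w i)%:P
  else ('X - (w i)%:P) * ('X - (w i + 1)%:P).
(* The degree of [num i], one less than that of [den i]. *)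
pose a i : nat := i \notin S.
have suma : \sum_i (a i).+1 = (2 * n + 2 - #|S|)%N.
  have -> : \sum_i (a i).+1 = (#|~: S| + n.+1)%N.
    under eq_bigr do rewrite -addn1; rewrite big_split /= sum1_card card_ord.
    congr (_ + _)%N; rewrite -sum1_card [RHS]big_mkcond; apply: eq_bigr => i _.
    by rewrite inE /a; case: (i \in S).
  by have := cardsC S; rewrite card_ord; lia.
have cS : (#|S| <= n.+1)%N by rewrite -[X in (_ <= X)%N]card_ord max_card.
have := @curve_degree K n B _ phi w num den a 'X d k f Bu.
rewrite suma size_polyX /= => H.
have -> : (2 * n + 1 - #|S|)%N = (2 * n + 2 - #|S|).-1 by lia.
suff -> : ((2 * n + 2 - #|S|).-1 + 2 = 1 + (2 * n + 2 - #|S|))%N; last by lia.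
apply: H => //.
- by move=> i; rewrite /den; case: ifP; rewrite ?monicMl ?monicXsubC.
- move=> i; rewrite /den /a; case: ifP => _ /=; first by rewrite size_XsubC.
  by rewrite size_monicM ?monicXsubC ?polyXsubC_eq0 // !size_XsubC.
- move=> i; rewrite /num /a; case: ifP => _ /=.
    by rewrite size_polyC leq_b1.
  by rewrite (leq_trans (size_scale_leq _ _)) // size_polyX.
- by move=> i; rewrite /num /a; case: ifP => _ /=;
    rewrite ?coefZ ?coefC ?coefX ?mulr1.
- move=> i j ij.
  have e1 : coprimep ('X - (w i)%:P) ('X - (w j)%:P).
    by rewrite coprimep_XsubC2 // wI // eq_sym.
  have e2 : coprimep ('X - (w i + 1)%:P) ('X - (w j)%:P).
    by rewrite coprimep_sym coprimep_XsubC2 // w1X.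
  have e3 : coprimep ('X - (w i)%:P) ('X - (w j + 1)%:P).
    by rewrite coprimep_XsubC2 // w1X.
  have e4 : coprimep ('X - (w i + 1)%:P) ('X - (w j + 1)%:P).
    by rewrite coprimep_XsubC2 // opprD addrACA subrr addr0 wI // eq_sym.
  by rewrite /den; case: ifP; case: ifP;
    rewrite ?coprimepMl ?coprimepMr ?e1 ?e2 ?e3 ?e4.
- exact: monicX.
- have e1 i : coprimep 'X ('X - (w i)%:P).
    by rewrite coprimep_sym coprimepX root_XsubC eq_sym w0.
  have e2 i : coprimep 'X ('X - (w i + 1)%:P).
    by rewrite coprimep_sym coprimepX root_XsubC eq_sym w1.
  by move=> i; rewrite /den; case: ifP; rewrite ?coprimepMr ?e1 ?e2.
- move=> i; have [P PZ Pi] := Ze i.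
  by apply: (curve_dvdp_vertex phi num den Bu Pi); apply: Zf.
(* At 0 the coordinates are [w i / (- w i) = -1] on [S] and 0 off [S], whence [lam = -1]. *)
apply: (curve_dvdp (mu := 1) (lam := -1) Bu Qv set_row_neq0).
- exact: coprimep1.
- move=> i; rewrite mxE /num /den mul1r; case: ifP => _.
    by rewrite rmorph1 mulr1 mulN1r opprK addrC subrK.
  by rewrite rmorph0 mulr0 mul0r subr0 -mul_polyC dvdp_mull.
exact: Zf.
Qed.

Lemma symbolic_power_degree_subframe k d f :
    (forall i, exists2 P, P \in Z & val P = <[delta_mx ord0 i *m B]>%VS) ->
    (exists2 P, P \in Z & val P = <[set_row *m B]>%VS) ->
    symbolic_power Z k f -> f \is d.-homog -> f != 0 ->
  ((2 * n + 1 - #|S| + 2) * k <= (2 * n + 1 - #|S|) * d)%N.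
Proof.
apply: (subframe_curve (phi := @genericC K n) (w := @genericX K n)).
- exact: generic_mmap_neq0.
- exact: genericX_neq0.
- exact: genericX_inj.
- exact: genericX1_neq0.
- exact: genericX1_neqX.
Qed.

End SubFrame.

(** * Products of forms *)

Section DualForms.
Variables (K : fieldType) (n : nat) (B : 'M[K]_n.+1).
Hypothesis Bu : B \in unitmx.
Implicit Types (P : pspace K n) (Z : {fset pspace K n}) (x : 'rV[K]_n.+1).

(** The coordinate functions of the frame formed by the rows of [B]. *)
Definition dual_form (i : 'I_n.+1) : {mpoly K[n.+1]} :=
  \sum_j invmx B j i *: 'X_j.

Lemma dual_form_homog i : dual_form i \is 1.-homog.
Proof.
by apply: rpred_sum => j _; apply: rpredZ; rewrite dhomogX; apply/eqP/mdeg1.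
Qed.

Lemma dual_form_eval i x :
  (dual_form i).@[fun j => (x *m B) ord0 j] = x ord0 i.
Proof.
rewrite -[in RHS](mulmxK Bu x) [RHS]mxE raddf_sum; apply: eq_bigr => j _.
by rewrite /= mevalZ mevalXU mulrC.
Qed.

Lemma vanishing_ideal_linear P x f :
    val P = <[x *m B]>%VS -> f \is 1.-homog ->
    f.@[fun j => (x *m B) ord0 j] = 0 ->
  vanishing_ideal [fset P]%fset f.
Proof. exact: vanishing_ideal_homog. Qed.

End DualForms.

(** A product of at most [N] factors of degree at most [D], chosen greedily: the last factor takes
    degree [minn d D], and the form is 1 once no degree is left. A factor of degree [j] has order
    [j] at a point, or [j - 1] if it misses the point, so the order lost is the number of misses. *)
Lemma homog_assemble (K : fieldType) n (Z : {fset pspace K n}) D N0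
    (miss : nat -> pspace K n -> bool) :
    (forall N j, (N < N0)%N -> (0 < j <= D)%N -> exists f : {mpoly K[n.+1]},
      [/\ f \is j.-homog, f != 0 & forall P, P \in Z ->
         ideal_pow (vanishing_ideal [fset P]%fset) (j - miss N P) f]) ->
  forall N d, (N <= N0)%N -> (d <= D * N)%N -> exists f : {mpoly K[n.+1]},
    [/\ f \is d.-homog, f != 0 & forall P, P \in Z ->
       ideal_pow (vanishing_ideal [fset P]%fset) (d - \sum_(i < N) miss i P) f].
Proof.
move=> Hm; elim=> [|N IH] d NN0 dN.
  exists 1; rewrite oner_eq0; move: dN; rewrite muln0 leqn0 => /eqP ->.
  by split=> //; exact: dhomog1.
have [->|d0] := posnP d.
  by exists 1; rewrite oner_eq0; split=> //; exact: dhomog1.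
have [|f [fd f0 fP]] := Hm N (minn d D) NN0; first by nia.
have [||g [gd g0 gP]] := IH (d - minn d D)%N; try nia.
exists (f * g); split.
- by rewrite (_ : d = minn d D + (d - minn d D))%N ?dhomogM //; lia.
- by rewrite mulf_neq0.
move=> P PZ; apply: ideal_powW (ideal_powM (fP P PZ) (gP P PZ)).
by rewrite big_ord_recr /=; lia.
Qed.

Lemma sum_eq_le1 m c : (\sum_(i < m) (val i == c) <= 1)%N.
Proof.
elim: m => [|m IH]; first by rewrite big_ord0.
rewrite big_ord_recr /=; case: eqP => [mc|_]; last by rewrite addn0.
by rewrite big1 // => i _; rewrite -mc ltn_eqF.
Qed.

Lemma sum_mod_le m c e : (0 < m)%N -> (\sum_(i < m * e) (i %% m == c) <= e)%N.
Proof.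
move=> m0; elim: e => [|e IH]; first by rewrite muln0 big_ord0.
rewrite mulnSr big_split_ord /= -[X in (_ <= X)%N]addn1; apply: leq_add => //.
apply: leq_trans (sum_eq_le1 m c); apply: leq_sum => i _.
by rewrite mulnC modnMDl modn_small.
Qed.

Lemma sum_pairs (F : nat -> nat) u :
  (\sum_(i < u) (F (2 * i) + F (2 * i).+1) = \sum_(i < 2 * u) F i)%N.
Proof.
elim: u => [|u IH]; first by rewrite muln0 !big_ord0.
by rewrite big_ord_recr /= mulnS add2n !big_ord_recr /= IH addnA.
Qed.

Lemma leq_sum_widen (F : nat -> nat) a b :
  (a <= b)%N -> (\sum_(i < a) F i <= \sum_(i < b) F i)%N.
Proof.
by move=> /subnKC <-; rewrite big_split_ord /= leq_addr.
Qed.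

(** Here [s] and [t] count the vertices in and off [S], and each point may be missed [e] times. A
    form missing two of the [s.+1] slots can then be used [(s.+1 * e)./2] times in all, and a form
    missing one vertex off [S] can be used [t * e] times. *)
Lemma subframe_arith k n s t : (s + t = n.+1)%N -> (0 < s)%N -> (0 < n)%N ->
    (0 < k)%N ->
  exists2 e, (k + e <= (s.+1 * e)./2 + t * e)%N
           & ((2 * n + 1 - s) * e <= 2 * (k.-1 + n))%N.
Proof.
move=> st s0 n0 k0; have -> : (2 * n + 1 - s = s.-1 + 2 * t)%N by lia.
set q := (_ + _)%N; have q0 : (0 < q)%N by rewrite /q; lia.
(* [e] is [2 * k / q] rounded up. *)
exists ((2 * k + q.-1) %/ q)%N; set e := (_ %/ _)%N.
  have : (2 * k <= q * e)%N.
    have := ltn_ceil (2 * k + q.-1)%N q0; rewrite -/e [(_ * q)%N]mulnC mulnS.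
    by move: (q * e)%N; lia.
  have -> : (s.+1 * e = 2 * e + s.-1 * e)%N by rewrite -mulnDl;
    congr (_ * _)%N; lia.
  rewrite /q mulnDl -mulnA.
  by move: (s.-1 * e)%N (t * e)%N => a b; lia.
have : (q * e <= 2 * k + q.-1)%N by rewrite mulnC leq_trunc_div.
(* For [s > 1] one has [q <= 2 * n - 1], which suffices. For [s = 1], [q = 2 * n] is even and parity
   gains the missing unit. *)
have [s1|s1] : s = 1%N \/ (1 < s)%N by lia.
  by rewrite /q s1 add0n -mulnA; move: (t * e)%N => a; lia.
by move: (q * e)%N => a; rewrite /q; lia.
Qed.

(** * Upper bound for a frame and a sum of some of its vertices *)

Section SubFrameForms.
Variables (K : fieldType) (n : nat) (B : 'M[K]_n.+1) (Z : {fset pspace K n}).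
Variable S : {set 'I_n.+1}.
Hypotheses (Bu : B \in unitmx) (S0 : (0 < #|S|)%N) (n0 : (0 < n)%N).

(* The vertices in [S] are the slots [c < #|S|], and [set_row] is the slot
   [#|S|]; the linear form [slot_form c - slot_form c'] vanishes at all points
   but those in the slots [c] and [c']. *)
Definition slot_form c : {mpoly K[n.+1]} :=
  if (c < #|S|)%N then dual_form B (nth ord0 (enum S) c) else 0.

(** The first [u] forms take pairs of consecutive slots cyclically; the later ones run cyclically
    through the coordinates off [S]. *)
Definition subframe_form u N : {mpoly K[n.+1]} :=
  if (N < u)%N then
    slot_form ((2 * N) %% #|S|.+1) - slot_form ((2 * N).+1 %% #|S|.+1)
  else dual_form B (nth ord0 (enum (~: S)) ((N - u) %% #|~: S|)).

Lemma slot_form_vertex c c' : (c' < #|S|)%N ->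
  (slot_form c).@[fun j =>
    ((delta_mx ord0 (nth ord0 (enum S) c') : 'rV_n.+1) *m B) ord0 j] =
  (c == c')%:R.
Proof.
move=> c'S; rewrite /slot_form; case: ifP => cS.
  by rewrite dual_form_eval // mxE eqxx nth_uniq ?enum_uniq -?cardE.
by rewrite meval0 gtn_eqF // (leq_trans c'S) // leqNgt cS.
Qed.

Lemma slot_form_row c : (c < #|S|.+1)%N ->
  (slot_form c).@[fun j => (set_row K S *m B) ord0 j] = (c != #|S|)%:R.
Proof.
rewrite ltnS leq_eqVlt /slot_form => /orP[/eqP ->|cS].
  by rewrite ltnn meval0 eqxx.
rewrite cS dual_form_eval // mxE (ltn_eqF cS) -mem_enum mem_nth //.
by rewrite -cardE.
Qed.

Lemma slot_form_homog c : slot_form c \is 1.-homog.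
Proof. by rewrite /slot_form; case: ifP; rewrite ?dual_form_homog ?dhomog0. Qed.

Lemma subframe_form_homog u N : subframe_form u N \is 1.-homog.
Proof.
rewrite /subframe_form; case: ifP => _; last exact: dual_form_homog.
by apply: rpredB; apply: slot_form_homog.
Qed.

Lemma slots_neq N : ((2 * N) %% #|S|.+1 != (2 * N).+1 %% #|S|.+1)%N.
Proof.
have := eqn_modDl (2 * N) 0 1 #|S|.+1; rewrite addn0 addn1 => ->.
by rewrite mod0n modn_small.
Qed.

Lemma subframe_form_neq0 u N : subframe_form u N != 0.
Proof.
rewrite /subframe_form; case: ifP => _; last first.
  apply/negP => /eqP /(congr1 (meval (fun j => ((\row__ 1 :
    'rV_n.+1) *m B) ord0 j))).
  by rewrite dual_form_eval // mxE meval0 => /eqP; rewrite oner_eq0.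
have := slots_neq N; set a := (_ %% _)%N; set b := (_ %% _)%N => ab.
have [aS bS] : (a < #|S|.+1 /\ b < #|S|.+1)%N by rewrite !ltn_mod.
(* The smaller of two distinct slots is a vertex in [S], and the difference of slot forms is nonzero
   there. *)
pose c := minn a b; have cS : (c < #|S|)%N.
  by move: aS bS ab; rewrite /c => {c}; move: a b #|S| => a b s; lia.
apply/negP => /eqP /(congr1 (meval (fun j =>
  ((delta_mx ord0 (nth ord0 (enum S) c) : 'rV_n.+1) *m B) ord0 j))).
rewrite mevalB meval0 !slot_form_vertex //.
have [[-> ->]|[-> ->]] : (a == c) = true /\ (b == c) = false \/
    (a == c) = false /\ (b == c) = true.
  by rewrite /c {c cS}; move: a b ab {aS bS} => a b; lia.
- by rewrite subr0 => /eqP; rewrite oner_eq0.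
by rewrite sub0r => /eqP; rewrite oppr_eq0 oner_eq0.
Qed.

Definition subframe_miss u N (P : pspace K n) : bool :=
  ~~ `[< vanishing_ideal [fset P]%fset (subframe_form u N) >].

Lemma subframe_miss_eval u N P (x : 'rV[K]_n.+1) (b : bool) :
    val P = <[x *m B]>%VS ->
    (~~ b -> (subframe_form u N).@[fun j => (x *m B) ord0 j] = 0) ->
  (subframe_miss u N P <= b)%N.
Proof.
move=> Px; case: b => [_|xb]; first exact: leq_b1.
rewrite leqn0 eqb0 negbK; apply/asboolP.
exact: vanishing_ideal_linear Px (subframe_form_homog _ _) (xb isT).
Qed.

(** Form number [i < u] can miss slot [c] only if [2 * i] or [2 * i + 1] is [c] modulo [#|S|.+1];
    the integers below [2 * u] meet this residue at most [e] times. The later forms vanish at the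
    point. *)
Lemma sum_subframe_miss_slot u v e P (x : 'rV[K]_n.+1) c :
    val P = <[x *m B]>%VS -> (2 * u <= #|S|.+1 * e)%N ->
    (forall l, l \notin S -> x ord0 l = 0) ->
    (forall a b, (a < #|S|.+1)%N -> (b < #|S|.+1)%N -> a != c -> b != c ->
       (slot_form a).@[fun j => (x *m B) ord0 j] =
       (slot_form b).@[fun j => (x *m B) ord0 j]) ->
    (v == 0)%N || (0 < #|~: S|)%N ->
  (\sum_(i < u + v) subframe_miss u i P <= e)%N.
Proof.
move=> Px ue xS xc v0; rewrite big_split_ord /= [X in (_ + X)%N]big1 ?addn0.
  apply: (leq_trans _ (sum_mod_le c e (ltn0Sn #|S|))).
  apply: (leq_trans _ (leq_sum_widen (fun i => (i %% #|S|.+1 == c)%N :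
    nat) ue)).
  rewrite -(sum_pairs (fun i => (i %% #|S|.+1 == c)%N : nat));
    apply: leq_sum => i _.
  apply: (@leq_trans (((2 * i) %% #|S|.+1 == c) ||
    ((2 * i).+1 %% #|S|.+1 == c))%N).
    apply: (subframe_miss_eval Px); rewrite negb_or => /andP[ac bc].
    rewrite /subframe_form ltn_ord mevalB; apply/eqP; rewrite subr_eq0;
      apply/eqP.
    by apply: xc; rewrite ?ltn_mod.
  by case: eqP; case: eqP.
move=> i _; apply/eqP; rewrite -leqn0.
apply: (subframe_miss_eval (b := false) Px) => _.
rewrite /subframe_form /= ltnNge leq_addr /= dual_form_eval // xS //.
have : nth ord0 (enum (~: S)) ((u + i - u) %% #|~: S|) \in ~: S.
  rewrite -mem_enum mem_nth // -cardE ltn_mod.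
  by case/orP: v0 => // /eqP v0; have := ltn_ord i; rewrite {2}v0.
by rewrite inE.
Qed.

Lemma sum_subframe_miss_free u e P l :
    val P = <[delta_mx ord0 l *m B]>%VS -> l \notin S ->
  (\sum_(i < u + #|~: S| * e) subframe_miss u i P <= e)%N.
Proof.
move=> Pl lS; rewrite big_split_ord /= [X in (X + _)%N]big1 ?add0n.
  have lC : l \in ~: S by rewrite inE.
  have C0 : (0 < #|~: S|)%N by apply/card_gt0P; exists l.
  apply: (leq_trans _ (sum_mod_le (index l (enum (~: S))) e C0)).
  apply: leq_sum => i _; apply: (subframe_miss_eval Pl) => il.
  rewrite /subframe_form /= ltnNge leq_addr /= dual_form_eval // mxE eqxx addKn.
  case: eqP => // nl; case/eqP: il; rewrite -nl index_uniq ?enum_uniq //.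
  by rewrite -cardE ltn_mod.
move=> i _; apply/eqP; rewrite -leqn0.
apply: (subframe_miss_eval (b := false) Pl) => _.
have slot0 c : (slot_form c).@[fun j => ((delta_mx ord0 l :
  'rV_n.+1) *m B) ord0 j] = 0.
  rewrite /slot_form; case: ifP => cS; last by rewrite meval0.
  rewrite dual_form_eval // mxE eqxx /=; case: eqP => // nl; case/negP: lS.
  by rewrite -nl -mem_enum mem_nth // -cardE.
by rewrite /subframe_form /= ltn_ord mevalB !slot0 subr0.
Qed.

Lemma symbolic_power_subframe_form k :
    (forall P, P \in Z -> (exists i, val P = <[delta_mx ord0 i *m B]>%VS) \/
       val P = <[set_row K S *m B]>%VS) ->
  exists e f, [/\ symbolic_power Z k f, f \is (k + e).-homog, f != 0
    & ((2 * n + 1 - #|S|) * e <= 2 * (k.-1 + n))%N].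
Proof.
move=> ZP; have sC : (#|S| + #|~: S| = n.+1)%N by rewrite cardsC card_ord.
have [->|k0] := posnP k.
  by exists 0%N, 1; rewrite muln0 leq0n oner_eq0 dhomog1.
have [e kuv ebound] := subframe_arith sC S0 n0 k0.
pose u := (#|S|.+1 * e)./2; pose v := (#|~: S| * e)%N.
have ue : (2 * u <= #|S|.+1 * e)%N by rewrite /u mul2n; move: (_ * e)%N => m;
  lia.
rewrite -/u -/v -[(u + v)%N]mul1n in kuv.
have [N j Nu j1|f [fd f0 fP]] := @homog_assemble K n Z 1 (u + v)
  (subframe_miss u) _ (u + v)%N (k + e)%N (leqnn _) kuv.
  have -> : j = 1%N by lia.
  exists (subframe_form u N); rewrite subframe_form_homog subframe_form_neq0.
  split=> // P PZ; rewrite /subframe_miss; case: asboolP => //= If.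
  exact: ideal_pow1.
exists e, f; split=> //.
move=> P /= PZ; apply: ideal_powW (fP P PZ).
suff : (\sum_(i < u + v) subframe_miss u i P <= e)%N by lia.
have v0 : (v == 0)%N || (0 < #|~: S|)%N by rewrite /v; case: posnP => [->|_];
  rewrite ?orbT.
have [[i Pi]|PS] := ZP P PZ.
  have [iS|iS] := boolP (i \in S); last exact: sum_subframe_miss_free Pi iS.
  have iE : i = nth ord0 (enum S) (index i (enum S))
    by rewrite nth_index ?mem_enum.
  have iS' : (index i (enum S) < #|S|)%N by rewrite cardE index_mem mem_enum.
  apply: (sum_subframe_miss_slot (c := index i
    (enum S)) Pi ue) => // [l lS|a b _ _ ai bi].
    by rewrite mxE eqxx /=; case: eqP => // li; rewrite li iS in lS.
  by rewrite iE !slot_form_vertex // (negbTE ai) (negbTE bi).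
apply: (sum_subframe_miss_slot (c := #|S|) PS ue) => // [l lS|a b aS bS ai bi].
  by rewrite mxE (negbTE lS).
by rewrite !slot_form_row // ai bi.
Qed.

End SubFrameForms.

(** * Secant varieties of the rational normal curve *)

Lemma det_row_mx_addl (R : comNzRingType) p q (A : 'M[R]_(p + q, p))
    (C : 'M_(p + q, q)) (V : 'M_(q, p)) :
  \det (row_mx (A + C *m V) C) = \det (row_mx A C).
Proof.
have -> : row_mx (A + C *m V) C = row_mx A C *m block_mx 1%:M 0 V 1%:M.
  by rewrite mul_row_block !mulmx1 mulmx0 add0r.
by rewrite det_mulmx det_lblock !det1 !mulr1.
Qed.

(** Each term of the Leibniz expansion has one factor from every column in [C], and at most [#|D|]
    of these lie in the exceptional rows. *)
Lemma ideal_pow_det (A : comNzRingType) (I : set A) N (M : 'M[A]_N)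
    (C D : pred 'I_N) :
    (forall i j, C j -> ~~ D i -> I (M i j)) ->
  ideal_pow I (#|C| - #|D|) (\det M).
Proof.
move=> CI; apply: ideal_pow_sum => s _; apply: ideal_powMl.
apply: (@ideal_powW _ _ _ (\sum_i (C (s i) && ~~ D i))%N); last first.
  apply: ideal_pow_prod => i _; case: andP => // -[Csi Di].
  exact/ideal_pow1/CI.
have cardE (E : pred 'I_N) : #|E| = (\sum_i E i)%N.
  by rewrite -sum1_card big_mkcond; apply: eq_bigr => i _; rewrite unfold_in;
    case: (E i).
rewrite leq_subLR !cardE [X in (X <= _)%N](reindex_inj (@perm_inj _ s)) /=.
by rewrite -big_split /=; apply: leq_sum => i _; case: (C _); case: (D i).
Qed.

Lemma dhomog_bigprod (R : comNzRingType) n (J : Type) (r : seq J) (P : pred J)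
    (F : J -> {mpoly R[n]}) (e : J -> nat) :
    (forall i, P i -> F i \is (e i).-homog) ->
  \prod_(i <- r | P i) F i \is (\sum_(i <- r | P i) e i).-homog.
Proof.
move=> Fe; elim/big_rec2: _ => [|i x y Pi hy]; first exact: dhomog1.
by apply: dhomogM hy; apply: Fe.
Qed.

Lemma dhomog_det (R : comNzRingType) n N (M : 'M[{mpoly R[n]}]_N)
  (e : 'I_N -> nat) :
    (forall i j, M i j \is (e j).-homog) -> \det M \is (\sum_j e j).-homog.
Proof.
move=> Me; apply: rpred_sum => s _.
have h : \prod_i M i (s i) \is (\sum_i e (s i)).-homog by apply: dhomog_bigprod.
have -> : (\sum_j e j = \sum_i e (s i))%N
  by rewrite (reindex_inj (@perm_inj _ s)).
rewrite mulr_sign.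
by case: ifP => _ //; rewrite dhomogN.
Qed.

Lemma poly_eq0_set (L : fieldType) (I : finType) (A : {pred I}) (c : I -> L)
    (p : {poly L}) :
    injective c -> (size p <= #|A|)%N -> (forall i, i \in A -> p.[c i]
      = 0) -> p = 0.
Proof.
move=> ci sp pc; apply: (@roots_geq_poly_eq0 _ p [seq c i | i <- enum A]).
- by apply/allP => _ /mapP[i iA ->]; apply/rootP/pc; rewrite -mem_enum.
- by rewrite map_inj_uniq ?enum_uniq.
by rewrite size_map -cardE.
Qed.

Section Loewner.
Variables (K : fieldType) (n : nat) (B : 'M[K]_n.+1) (b : 'I_n.+1 -> K)
  (t : nat).
Hypotheses (Bu : B \in unitmx) (b0 : forall i, b i != 0) (b_inj : injective b).
Hypothesis tn : (t.+1 + t <= n.+1)%N.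
Local Notation rw := (widen_ord tn).
Local Notation ell := (dual_form B).

(** With nodes [a_i = 1 / b_i], the curve [s |-> (1 / (s - a_i))_i] meets the vertices at the nodes,
    [const_mx 1] at infinity and [b] at [s = 0]. *)
Definition node i := (b (rw i))^-1.

Lemma node_inj : injective node.
Proof. by move=> i j /invr_inj/b_inj/(congr1 val)/= /val_inj. Qed.

(* On the span of [t] points of the rational normal curve
   [s |-> (1 / (s - a_i))_i] one has [x_i = p(a_i) / q(a_i)] with [deg p < t]
   and [deg q <= t], so the equations [x_i * q(a_i) - p(a_i) = 0], linear in
   the coefficients of [q] and [p], are dependent. *)
Definition loewner_l : 'M[{mpoly K[n.+1]}]_(t.+1 + t, t.+1) :=
  \matrix_(i, j) (node i ^+ j *: ell (rw i)).
Definition loewner_r : 'M[{mpoly K[n.+1]}]_(t.+1 + t, t) :=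
  \matrix_(i, j) (node i ^+ j)%:MP.
Definition loewner := \det (row_mx loewner_l loewner_r).

Lemma loewner_homog : loewner \is t.+1.-homog.
Proof.
have -> : t.+1 = (\sum_(j < t.+1 + t) (j < t.+1))%N.
  rewrite big_split_ord /= [X in (_ + X)%N]big1 ?addn0 => [|i _]; last first.
    by rewrite ltnNge leq_addr.
  by under eq_bigr do rewrite ltn_ord; rewrite sum1_card card_ord.
apply: dhomog_det => i j; case: (splitP j) => l jl.
  have -> : j = lshift _ l by apply/val_inj.
  by rewrite row_mxEl mxE; apply/rpredZ/dual_form_homog.
have -> : j = rshift _ l by apply/val_inj.
rewrite row_mxEr mxE.
by rewrite -[_%:MP]mulr1 mul_mpolyC; apply/rpredZ/dhomog1.
Qed.

(** Specialize to the indicator [x] of the first [t.+1] coordinates. In a dependency, [de] vanishes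
    at the last [t] nodes, hence is 0; then [al] vanishes at the first [t.+1] nodes, hence is 0. *)
Lemma loewner_neq0 : loewner != 0.
Proof.
pose x : 'rV[K]_n.+1 := \row_l (l < t.+1)%:R.
pose ev := meval (fun j => (x *m B) ord0 j).
apply/negP => /eqP/(congr1 ev); rewrite /ev meval0 -det_map_mx -det_tr.
set M := (_^T)%R => /eqP/det0P[v v0 vM].
pose al : {poly K} := \poly_(j < t.+1) v ord0 (inord j).
pose de : {poly K} := \poly_(j < t) v ord0 (inord (t.+1 + j)).
have rel (i : 'I_(t.+1 + t)) : (i < t.+1)%:R * al.[node i] + de.[node i] = 0.
  have /matrixP/(_ ord0 i) := vM; rewrite !mxE big_split_ord /= => <-.
  rewrite !horner_poly mulr_sumr; congr (_ + _); apply: eq_bigr => j _.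
    have -> : inord j = lshift t j.
      apply/val_inj; rewrite /= inordK //.
      by rewrite -addSn ltn_addr.
    rewrite 2!mxE row_mxEl mxE /= mevalZ dual_form_eval // mxE.
    by ring.
  have -> : inord (t.+1 + j) = rshift t.+1 j.
    apply/val_inj; rewrite /= inordK //.
    by rewrite ltnS addSn ltn_add2l.
  by rewrite 2!mxE row_mxEr mxE /= mevalC.
have de0 : de = 0.
  apply: (poly_eq0_set (A := 'I_t) (c := fun i => node
    (rshift t.+1 i))) => [i j /node_inj||i _].
  - exact: rshift_inj.
  - by rewrite card_ord size_poly.
  by have := rel (rshift t.+1 i); rewrite /= ltnNge leq_addr mul0r add0r.
have al0 : al = 0.
  apply: (poly_eq0_set (A := 'I_t.+1) (c := fun i => node
    (lshift t i))) => [i j /node_inj||i _].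
  - exact: lshift_inj.
  - by rewrite card_ord size_poly.
  by have := rel (lshift t i); rewrite /= ltn_ord mul1r de0 horner0 addr0.
case/negP: v0; apply/eqP/rowP => j; rewrite mxE; case: (splitP j) => l jl.
  have := congr1 (fun p : {poly K} => p`_l) al0;
    rewrite coef_poly ltn_ord coef0 => <-.
  by congr (v _ _); apply/val_inj; rewrite /= -jl inordK.
have := congr1 (fun p : {poly K} => p`_l) de0;
  rewrite coef_poly ltn_ord coef0 => <-.
by congr (v _ _); apply/val_inj; rewrite /= -jl inordK.
Qed.

(** All entries of the [t.+1] left columns vanish at the vertex, except in the row of [ell l]. There
    is no such row if [l] is beyond the first [2 * t + 1] coordinates: the hypersurface is a cone
    with that vertex. *)
Lemma loewner_vertex P l :
    val P = <[(delta_mx ord0 l : 'rV_n.+1) *m B]>%VS ->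
  ideal_pow (vanishing_ideal [fset P]%fset) (t + (t.+1 + t <= l)) loewner.
Proof.
move=> Pl; have Il i : i != l -> vanishing_ideal [fset P]%fset (ell i).
  move=> il; apply: (vanishing_ideal_linear Pl (dual_form_homog _ _)).
  by rewrite dual_form_eval // mxE (negbTE il).
pose C := [pred j : 'I_(t.+1 + t) | (j < t.+1)%N].
pose D := [pred i : 'I_(t.+1 + t) | rw i == l].
have cC : #|C| = t.+1.
  rewrite -sum1_card big_split_ord /= (eq_bigl xpredT) => [|j]; last first.
    by rewrite unfold_in /= ltn_ord.
  rewrite sum1_card card_ord big1 ?addn0 // => j.
  by rewrite unfold_in /= ltnNge leq_addr.
have cD : (#|D| <= ~~ (t.+1 + t <= l))%N.
  case: leqP => lt /=.
    apply/(@card_le1_eqP _ D) => i j; rewrite !unfold_in /= => /eqP il /eqP jl.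
    by have := etrans il (esym jl) => /(congr1 val)/= /val_inj.
  rewrite leqn0; apply/eqP/eq_card0 => i; rewrite !unfold_in /=.
  by apply/negP => /eqP/(congr1 val) /= il; move: (ltn_ord i);
    rewrite il ltnNge lt.
apply: ideal_powW (ideal_pow_det (C := C) (D := D) _); last first.
  move=> i j jC iD; have -> : j = lshift _ (Ordinal (jC :
    (j < t.+1)%N)) by apply/val_inj.
  by rewrite row_mxEl mxE /= -mul_mpolyC; apply/ideal_genM/Il.
by rewrite cC; move: cD; case: (_ <= l)%N; move: #|D| => x /=; lia.
Qed.

(** All [ell i] agree at this point, so subtracting [ell ord0] times the right columns makes the
    first [t] left columns vanish there. *)
Lemma loewner_row P :
    val P = <[(const_mx 1 : 'rV_n.+1) *m B]>%VS ->
  ideal_pow (vanishing_ideal [fset P]%fset) t loewner.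
Proof.
move=> P1; pose V : 'M[{mpoly K[n.+1]}]_(t, t.+1) :=
  \matrix_(i, j) (- (val i == val j)%:R * ell ord0).
rewrite /loewner -(det_row_mx_addl _ _ V).
pose C := [pred j : 'I_(t.+1 + t) | (j < t)%N].
have cC : (t <= #|C|)%N.
  by rewrite -sum1_card (big_ord_narrow (leq_addl t.+1 t)) sum1_card card_ord.
apply: ideal_powW (ideal_pow_det (C := C) (D := pred0) _).
  by rewrite card0 subn0.
move=> i j jC _; have jt : (j < t)%N := jC.
have -> : j = lshift _ (Ordinal (ltnW jt : (j < t.+1)%N)) by apply/val_inj.
rewrite row_mxEl !mxE (bigD1 (Ordinal jt)) //= !mxE eqxx big1 => [|l lj];
  last first.
  have {}lj : val l == j = false.
    by apply/eqP => lj'; case/eqP: lj; apply/val_inj.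
  by rewrite !mxE /= lj oppr0 mul0r mulr0.
rewrite addr0 mulN1r mulrN -mul_mpolyC -mulrBr; apply: ideal_genM.
apply: (vanishing_ideal_linear P1); first by rewrite rpredB ?dual_form_homog.
by rewrite mevalB !dual_form_eval // !mxE subrr.
Qed.

(** As for [const_mx 1], with the columns shifted by one: [node i * ell i] takes the value 1 at [b]
    for every [i], so left column [j] is cleared by right column [j - 1]. *)
Lemma loewner_param P :
    val P = <[(\row_i b i) *m B]>%VS ->
  ideal_pow (vanishing_ideal [fset P]%fset) t loewner.
Proof.
move=> Pb; pose V : 'M[{mpoly K[n.+1]}]_(t, t.+1) :=
  \matrix_(i, j) (- ((val i).+1 == val j)%:R * ((b ord0)^-1 *: ell ord0)).
rewrite /loewner -(det_row_mx_addl _ _ V).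
pose C := [pred j : 'I_(t.+1 + t) | (0 < j < t.+1)%N].
have cC : (t <= #|C|)%N.
  rewrite -[X in (X <= _)%N](card_ord t).
  rewrite -(card_imset (mem 'I_t) (inj_comp (@lshift_inj t.+1 t)
    (@lift_inj t.+1 ord0))).
  apply: subset_leq_card; apply/fintype.subsetP => _ /imsetP[i _ ->].
  by rewrite unfold_in /= /bump leq0n add1n ltnS ltn_ord.
apply: ideal_powW (ideal_pow_det (C := C) (D := pred0) _).
  by rewrite card0 subn0.
move=> i j jC _; have /andP[j0 jt] : (0 < j < t.+1)%N := jC.
have jt' : (j.-1 < t)%N by rewrite prednK.
have -> : j = lshift _ (Ordinal (jt : (j < t.+1)%N)) by apply/val_inj.
rewrite row_mxEl !mxE (bigD1
  (Ordinal jt')) //= !mxE /= prednK // eqxx big1 => [|l lj]; last first.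
  have {}lj : l.+1 == j = false.
    by apply/eqP => lj'; case/eqP: lj; apply/val_inj; rewrite /= -lj'.
  by rewrite !mxE /= lj oppr0 mul0r mulr0.
rewrite addr0 mulN1r mulrN -[in node i ^+ j](prednK j0) exprSr -scalerA -[X in
  X - _]mul_mpolyC.
rewrite -mulrBr; apply: ideal_genM; apply: (vanishing_ideal_linear Pb).
  by rewrite rpredB ?rpredZ ?dual_form_homog.
by rewrite mevalB !mevalZ !dual_form_eval // !mxE !mulVf // subrr.
Qed.

End Loewner.

(** * The curve for odd n *)

(* The columns are the linear conditions [x i * al.[a i] = de.[a i]] and
   [\sum_j al`_j * ph j = 0] on the coefficients of [al] and [de]. *)
Definition interp_mx (R : comNzRingType) m n (x a : 'I_n.+1 -> R)
  (ph : nat -> R) :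
    'M[R]_n.+2 :=
  \matrix_(j, i) if unlift ord_max i is Some i' then
      (if (j < m.+2)%N then x i' * a i' ^+ j else - a i' ^+ (j - m.+2))
    else if (j < m.+2)%N then ph j else 0.

Lemma map_interp_mx (R S : comNzRingType) (f : {rmorphism R -> S}) m n
    (x a : 'I_n.+1 -> R) ph :
  map_mx f (interp_mx m x a ph) = interp_mx m (f \o x) (f \o a) (f \o ph).
Proof.
apply/matrixP => j i; rewrite !mxE; case: unliftP => [i' _|_];
  case: ifP => _ //=.
- by rewrite rmorphM rmorphXn.
- by rewrite rmorphN rmorphXn.
by rewrite rmorph0.
Qed.

Section Interpolation.
Variables (L : fieldType) (m n : nat).
Hypothesis nm : n = (2 * m + 1)%N.
Implicit Types (x a : 'I_n.+1 -> L) (ph : nat -> L) (al de : {poly L}).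

(** A left kernel vector lists the [m.+2] coefficients of [al], then the [m.+1] of [de]. *)
Lemma interp_det0P x a ph :
  reflect (exists al de, [/\ (size al <= m.+2)%N, (size de <= m.+1)%N,
      (al != 0) || (de != 0), forall i, x i * al.[a i] = de.[a i]
      & \sum_(j < m.+2) al`_j * ph j = 0])
    (\det (interp_mx m x a ph) == 0).
Proof.
have n2 : n.+2 = (m.+2 + m.+1)%N by rewrite nm; lia.
have eval (v : 'rV[L]_n.+2) al de :
  (size al <= m.+2)%N -> (size de <= m.+1)%N ->
    (forall j, v ord0 j = if (j < m.+2)%N then al`_j else de`_(j - m.+2)) ->
    v *m interp_mx m x a ph = 0 <-> (forall i, x i * al.[a i] = de.[a i]) /\
      \sum_(j < m.+2) al`_j * ph j = 0.
  move=> sal sde vE.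
  have eN (F : nat -> L) : \sum_(j < n.+2) F j =
      \sum_(j < m.+2) F j + \sum_(j < m.+1) F (m.+2 + j)%N.
    by rewrite n2 big_split_ord.
  have e1 i : (v *m interp_mx m x a ph) ord0 (lift ord_max i) =
      x i * al.[a i] - de.[a i].
    pose F j := (if (j < m.+2)%N then al`_j else de`_(j - m.+2)) *
      (if (j < m.+2)%N then x i * a i ^+ j else - a i ^+ (j - m.+2)).
    rewrite mxE; transitivity (\sum_(j < n.+2) F j).
      by apply: eq_bigr => j _; rewrite mxE liftK vE.
    rewrite eN (horner_coef_wide _ sal)
      (horner_coef_wide _ sde) mulr_sumr -sumrN.
    congr (_ + _); apply: eq_bigr => j _; rewrite /F.
      by rewrite ltn_ord mulrCA.
    by rewrite ltnNge leq_addr /= addKn mulrN.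
  have e2 : (v *m interp_mx m x a ph) ord0 ord_max
    = \sum_(j < m.+2) al`_j * ph j.
    pose F j := (if (j < m.+2)%N then al`_j else de`_(j - m.+2)) *
      (if (j < m.+2)%N then ph j else 0).
    rewrite mxE; transitivity (\sum_(j < n.+2) F j).
      by apply: eq_bigr => j _; rewrite mxE unlift_none vE.
    rewrite eN [X in _ + X]big1 ?addr0 => [|j _]; last first.
      by rewrite /F ltnNge leq_addr mulr0.
    by apply: eq_bigr => j _; rewrite /F ltn_ord.
  split=> [v0|[rel ph0]].
    split=> [i|]; last by rewrite -e2 v0 mxE.
    by apply/eqP; rewrite -subr_eq0 -e1 v0 mxE.
  apply/rowP => i; rewrite [RHS]mxE; case: (unliftP ord_max i) => [i' ->|->].
    by rewrite e1 rel subrr.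
  by rewrite e2.
apply: (iffP det0P) => [[v v0 /eval H]|[al [de [sal sde ad0 rel ph0]]]].
  pose al := \poly_(j < m.+2) v ord0 (inord j).
  pose de := \poly_(j < m.+1) v ord0 (inord (m.+2 + j)).
  have vE j : v ord0 j = if (j < m.+2)%N then al`_j else de`_(j - m.+2).
    rewrite !coef_poly; case: ltnP => jm; first by rewrite inord_val.
    rewrite subnKC // inord_val ltn_subLR // -n2 ltn_ord //.
  have [rel ph0] := H al de (size_poly _ _) (size_poly _ _) vE.
  exists al, de; split; rewrite ?size_poly //.
  apply: contraNT v0; rewrite negb_or !negbK => /andP[/eqP al0 /eqP de0].
  by apply/eqP/rowP => j; rewrite vE al0 de0 !coef0 mxE if_same.
pose v : 'rV[L]_n.+2 := \row_j (if (j < m.+2)%N then al`_j else de`_(j - m.+2)).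
exists v; last by apply/(eval v al de sal sde) => // j; rewrite mxE.
apply: contraTneq ad0 => v0; rewrite negb_or !negbK; apply/andP; split;
  apply/eqP/polyP => j.
  rewrite coef0; have [jm|jm] := ltnP j m.+2;
    last by rewrite nth_default // (leq_trans sal).
  have jn : (j < n.+2)%N by rewrite n2 ltn_addr.
  by have /rowP/(_ (Ordinal jn)) := v0; rewrite !mxE /= jm.
rewrite coef0; have [jm|jm] := ltnP j m.+1;
  last by rewrite nth_default // (leq_trans sde).
have jn : (m.+2 + j < n.+2)%N by rewrite n2 ltn_add2l.
by have /rowP/(_ (Ordinal jn)) := v0; rewrite !mxE /= ltnNge leq_addr /= addKn.
Qed.

(* Specializing to [x = 1_S] forces [de = 0] off [S] and makes [al] a multiple
   of [\prod_(i in S) ('X - a i)]. *)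
Lemma interp_det_set (S : {set 'I_n.+1}) a ph :
    injective a -> #|S| = m.+1 ->
    \sum_(j < m.+2) (\prod_(i in S) ('X - (a i)%:P))`_j * ph j != 0 ->
  \det (interp_mx m (fun i => (i \in S)%:R) a ph) != 0.
Proof.
move=> ai Sm; set p := \prod_(i in S) _ => phS.
have sp : size p = m.+2 by rewrite /p -big_enum /= size_prod_XsubC -cardE Sm.
have pm : p \is monic by apply: monic_prod => i _; apply: monicXsubC.
apply/negP => /interp_det0P[al [de [sal sde ad0 rel ph0]]].
have de0 : de = 0.
  apply: (poly_eq0_set (A := ~: S) ai) => [|i].
    by rewrite (leq_trans sde) //; have := cardsC S; rewrite card_ord Sm;
      move: #|~: S| => x; lia.
  by rewrite inE => /negbTE iS; rewrite -rel iS mul0r.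
pose c := al`_m.+1; have alE : al = c *: p.
  apply/eqP; rewrite -subr_eq0; apply/eqP.
  apply: (poly_eq0_set (A := S) ai) => [|i iS].
    rewrite Sm; apply/leq_sizeP => j; rewrite leq_eqVlt => /orP[/eqP <-|mj].
      have : p`_m.+1 = 1 by have /monicP := pm; rewrite lead_coefE sp.
      by rewrite coefB coefZ => ->; rewrite mulr1 subrr.
    by rewrite coefB coefZ nth_default ?(leq_trans sal) // nth_default ?sp //
      mulr0 subrr.
  have ai0 : al.[a i] = 0 by have := rel i; rewrite iS mul1r de0 horner0.
  by rewrite hornerD hornerN ai0 sub0r hornerZ /p
    (bigD1 i) //= hornerM hornerXsubC subrr mul0r mulr0 oppr0.
have /eqP : c * \sum_(j < m.+2) p`_j * ph j = 0.
  by rewrite -[RHS]ph0 alE mulr_sumr; apply: eq_bigr => j _;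
    rewrite coefZ mulrA.
rewrite mulf_eq0 (negbTE phS) orbF => /eqP c0.
by move: ad0; rewrite de0 alE c0 scale0r eqxx.
Qed.

Lemma horner_coef_m2 (F : fieldType) (p : {poly F}) z : (size p <= m.+2)%N ->
  \sum_(j < m.+2) p`_j * z ^+ j = p.[z].
Proof. by move=> s; rewrite (horner_coef_wide _ s). Qed.

Lemma coef_m1 (F : fieldType) (p : {poly F}) :
  \sum_(j < m.+2) p`_j * (val j == m.+1)%:R = p`_m.+1.
Proof.
rewrite big_ord_recr /= eqxx mulr1 big1 ?add0r // => j _.
by rewrite (ltn_eqF (ltn_ord j)) mulr0.
Qed.

(** Rational interpolation by [de / al]. The three kinds of determinants exclude solutions with [al]
    of lower degree, with root 0, or with a root at a node. A common factor of [al] and [de] could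
    be cancelled, giving a solution of lower degree. *)
Lemma interp_coprime x a :
    \det (interp_mx m x a (fun j => (j == m.+1)%:R)) != 0 ->
    \det (interp_mx m x a (fun j => 0 ^+ j)) != 0 ->
    (forall i, \det (interp_mx m x a (fun j => a i ^+ j)) != 0) ->
  exists al de : {poly L},
    [/\ al \is monic, size al
      = m.+2, (size de <= m.+1)%N, al.[0] != 0 & coprimep al de /\
       forall i, x i * al.[a i] = de.[a i]].
Proof.
move=> detoo det0 deta.
(* With [ph = 0] the last column is zero: [n.+1] conditions on [n.+2] coefficients have a nonzero
   solution. *)
have /interp_det0P[al [de [sal sde ad0 rel _]]] :
    \det (interp_mx m x a (fun=> 0)) == 0.
  rewrite -det_tr; apply/det0P; exists (delta_mx ord0 ord_max).
    by apply/eqP => /rowP/(_ ord_max)/eqP; rewrite !mxE !eqxx oner_eq0.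
  by rewrite -rowE; apply/rowP => j; rewrite !mxE unlift_none if_same.
have phal ph : \det (interp_mx m x a ph) != 0
  -> \sum_(j < m.+2) al`_j * ph j != 0.
  by apply: contraNneq => ph0; apply/interp_det0P; exists al, de.
have th0 : al`_m.+1 != 0 by rewrite -coef_m1;
  exact: (phal (fun j => (j == m.+1)%:R)).
have al0 : al.[0] != 0 by rewrite -horner_coef_m2 //;
  exact: (phal (fun j => 0 ^+ j)).
have ala i : al.[a i] != 0 by rewrite -horner_coef_m2 //;
  exact: (phal (fun j => a i ^+ j)).
pose th := al`_m.+1; exists (th^-1 *: al), (th^-1 *: de).
have sA : size al = m.+2.
  by apply/eqP; rewrite eqn_leq sal ltnNge;
    apply: contra th0 => /(nth_default 0)->.
have thV : th^-1 != 0 by rewrite invr_eq0.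
rewrite !size_scale // hornerZ mulf_neq0 //; split=> //.
  by rewrite monicE lead_coefZ lead_coefE sA mulVf.
split=> [|i]; last by rewrite !hornerZ mulrCA rel.
rewrite coprimepZl // coprimepZr // coprimep_def.
have alN0 : al != 0 by rewrite -size_poly_gt0 sA.
set g := gcdp al de; have g0 : g != 0 by rewrite gcdp_eq0 negb_and alN0.
have /dvdpP[al' alE] : g %| al by apply: dvdp_gcdl.
have /dvdpP[de' deE] : g %| de by apply: dvdp_gcdr.
rewrite eqn_leq [(1 <= _)%N]size_poly_gt0 g0 andbT leqNgt; apply/negP => g1.
case/negP: detoo; apply/interp_det0P; exists al', de'.
have al'0 : al' != 0 by apply: contraNneq alN0 => al'0; rewrite alE al'0 mul0r.
have sal' : (size al' <= m.+1)%N.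
  by have := sA; rewrite alE size_mul //; move: g1; move: (size g) (size al');
    lia.
split; rewrite ?al'0 //; first exact: leqW.
- have [->|de'0] := eqVneq de' 0; first by rewrite size_poly0.
  by move: sde; rewrite deE size_mul //; move: g1; move: (size g) (size de');
    lia.
- move=> i; have gi : g.[a i] != 0.
    by move: (ala i); rewrite alE hornerM mulf_eq0 negb_or => /andP[].
  by apply: (mulIf gi); rewrite -mulrA -!hornerM -alE -deE rel.
by rewrite coef_m1 nth_default.
Qed.

End Interpolation.

Section GenericInterpolation.
Variables (K : fieldType) (m n : nat) (b : 'I_n.+1 -> K).
Hypothesis nm : n = (2 * m + 1)%N.
Hypotheses (b0 : forall i, b i != 0) (b_inj : injective b).
Local Notation a := (fun i => (b i)^-1).

(** The determinants are polynomials in the generic coordinates, and are nonzero at the indicator of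
    a set [S] of [m.+1] indices. For the condition at node [i], [S] is chosen to avoid [i]. *)
Lemma generic_interpolation : exists al de : {poly genericField K n},
  [/\ al \is monic, size al
    = m.+2, (size de <= m.+1)%N, al.[0] != 0 & coprimep al de /\
     forall i, genericX K i * al.[genericC K n (a i)]
       = de.[genericC K n (a i)]].
Proof.
have ai : injective a by move=> i j /invr_inj/b_inj.
pose M ph := interp_mx m (@genericX K n) (genericC K n \o a)
  (genericC K n \o ph).
have detM (S : {set 'I_n.+1}) (ph : nat -> K) : #|S| = m.+1 ->
    \sum_(j < m.+2) (\prod_(i in S) ('X - (a i)%:P))`_j * ph j != 0 ->
    \det (M ph) != 0.
  move=> Sm phS; pose MX := interp_mx m (fun i => 'X_i) (@mpolyC n.+1 K \o a)
    (@mpolyC n.+1 K \o ph).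
  have -> : M ph = map_mx (@tofrac _) MX by rewrite map_interp_mx.
  rewrite det_map_mx; apply: (@tofrac_neq0 _ _ _ (fun i => (i \in S)%:R)).
  rewrite -det_map_mx map_interp_mx.
  have -> : interp_mx m (meval (fun i => (i \in S)%:R) \o (fun i => 'X_i))
      (meval (fun i => (i \in S)%:R) \o (@mpolyC n.+1 K \o a))
      (meval (fun i => (i \in S)%:R) \o (@mpolyC n.+1 K \o ph)) =
      interp_mx m (fun i : 'I_n.+1 => (i \in S)%:R) a ph.
    by congr interp_mx; apply/funext => i /=; rewrite ?mevalXU ?mevalC.
  exact: interp_det_set.
have exS i : exists2 S : {set 'I_n.+1}, #|S| = m.+1 & i \notin S.
  have : (0 < #|[set S : {set 'I_n.+1} | (S \subset ~:
    [set i]) && (#|S| == m.+1)]|)%N.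
    rewrite cards_draws cardsC1 card_ord bin_gt0 /=; lia.
  case/card_gt0P => S; rewrite inE => /andP[/fintype.subsetP Si /eqP Sm].
  by exists S => //; apply/negP => /Si; rewrite !inE eqxx.
have sp (S : {set 'I_n.+1}) : #|S| = m.+1 ->
    size (\prod_(i in S) ('X - (a i)%:P)) = m.+2.
  by move=> Sm; rewrite -big_enum /= size_prod_XsubC -cardE Sm.
have detz i z : (forall j, j != i -> z != a j)
  -> \det (M (fun j => z ^+ j)) != 0.
  move=> zi; have [S Sm iS] := exS i; apply: (detM S) => //.
  rewrite (horner_coef_m2 _) ?sp // horner_prod; apply/prodf_neq0 => j jS.
  by rewrite hornerXsubC subr_eq0 zi //; apply: contraNneq iS => <-.
have detoo : \det (M (fun j => (j == m.+1)%:R)) != 0.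
  have [S Sm iS] := exS ord0; apply: (detM S) => //.
  have /monicP : \prod_(i in S) ('X - (a i)%:P) \is monic.
    by apply: monic_prod => i _; apply: monicXsubC.
  by rewrite (coef_m1 m) lead_coefE sp // => ->; rewrite oner_eq0.
apply: (interp_coprime nm).
- rewrite [X in interp_mx _ _ _ X](_ :
    _ = genericC K n \o (fun j => (j == m.+1)%:R)) //.
  by apply/funext => j; apply/esym/rmorph_nat.
- rewrite [X in interp_mx _ _ _ X](_ : _ = genericC K n \o (fun j => 0 ^+ j)).
    by apply: (detz ord0) => j _; rewrite eq_sym invr_eq0.
  apply/funext => j; apply/esym;
    rewrite -[RHS](_ : genericC K n 0 ^+ j = _) ?rmorph0 //.
  exact: rmorphXn.
move=> i; rewrite [X in interp_mx _ _ _ X](_ :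
  _ = genericC K n \o (fun j => a i ^+ j)).
  by apply: (detz i) => j ji; rewrite (inj_eq ai) eq_sym.
by apply/funext => j; apply/esym/rmorphXn.
Qed.

End GenericInterpolation.

(** * Lower bound for n + 3 points, n odd *)

Section SecantCurve.
Variables (K : fieldType) (m n : nat) (B : 'M[K]_n.+1) (Z : {fset pspace K n}).
Variable b : 'I_n.+1 -> K.
Hypotheses (nm : n = (2 * m + 1)%N) (Bu : B \in unitmx).
Hypotheses (b0 : forall i, b i != 0) (b_inj : injective b).

(* The numerators form the Bezoutian of [al] and [be = al - de].  The curve is
   [x_i = num i / den i], where [('X - a i) * num i = w i *: al - de] and
   [('X - a i) * den i = 'X * be - a i * (1 - w i) * al]; it passes through the
   generic point [w] at infinity, through [const_mx 1] along [al], through [b]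
   along [be], and through each vertex [m.+1] times. *)
Lemma secant_curve (L : fieldType) (phi : {rmorphism K -> L}) (w : 'I_n.+1 -> L)
    (al de : {poly L}) k d f :
    (forall g, g != 0 -> mmap phi w g != 0) ->
    (forall i, w i != 0) -> (forall i, 1 - w i != 0) ->
    (forall i j, i != j -> phi (b i)^-1 * (1 - w i) != phi (b j)^-1 *
      (1 - w j)) ->
    al \is monic -> size al = m.+2 -> (size de <= m.+1)%N -> al.[0] != 0 ->
    coprimep al de -> (forall i, w i * al.[phi (b i)^-1] = de.[phi (b i)^-1]) ->
    (forall i, exists2 P, P \in Z & val P = <[delta_mx ord0 i *m B]>%VS) ->
    (exists2 P, P \in Z & val P = <[(const_mx 1 : 'rV_n.+1) *m B]>%VS) ->
    (exists2 P, P \in Z & val P = <[(\row_i b i) *m B]>%VS) ->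
    symbolic_power Z k f -> f \is d.-homog -> f != 0 ->
  ((m.+1 * (2 * m + 4)) * k <= (2 * m ^ 2 + 4 * m + 1) * d)%N.
Proof.
have ar1 : (n.+1 * m.+1 = (2 * m + 2) * m.+1)%N by rewrite nm; nia.
have ar2 : ((2 * m + 2) + (2 * m + 2) * m.+1 = m.+1 * (2 * m + 4))%N by nia.
have ar3 : ((2 * m + 2) * m.+1).-1 = (2 * m ^ 2 + 4 * m + 1)%N by nia.
have ar4 : (m.+2 + m.+2).-2 = (2 * m + 2)%N by lia.
move=> wP w0 w1 wI alm sal sde al0 cad rel Ze [Q1 Q1Z Q1v] [Qb QbZ Qbv] Zf fd
  f0.
pose a i := phi (b i)^-1; pose be := al - de.
pose num i := (w i *: al - de) %/ ('X - (a i)%:P).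
pose den i := 'X * num i + (1 - w i) *: al.
have a0 i : a i != 0 by rewrite fmorph_eq0 invr_eq0.
have numE i : num i * ('X - (a i)%:P) = w i *: al - de.
  apply: divpK; rewrite dvdp_XsubCl; apply/rootP.
  by rewrite hornerD hornerN hornerZ rel subrr.
have top i : (w i *: al - de)`_m.+1 = w i.
  rewrite coefB coefZ [de`_ _]nth_default // subr0.
  by have /monicP := alm; rewrite lead_coefE sal => ->; rewrite mulr1.
have sn i : size (num i) = m.+1.
  have : size (w i *: al - de) = m.+2.
    by rewrite size_polyDl size_scale ?sal // size_polyN.
  rewrite -numE; have [->|n0] := eqVneq (num i) 0;
    first by rewrite mul0r size_poly0.
  by rewrite size_Mmonic ?monicXsubC // size_XsubC addn2 /= => -[].
have numc i : (num i)`_m = w i.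
  have := top i; rewrite -numE -addn1.
  have [_ ->] := @coefM_top L (num i) ('X - (a i)%:P) m 1
    (eq_leq (sn i)) (eq_leq (size_XsubC _)).
  by rewrite coefB coefX coefC subr0 mulr1.
(* All coprimality claims are read off this identity, since [al] is coprime to ['X * be] and its
   coefficient is nonzero. *)
have denE i : den i * ('X - (a i)%:P) = 'X * be - (a i * (1 - w i)) *: al.
  rewrite /den mulrDl -mulrA numE /be -!mul_polyC !polyCM; ring.
have den_be i : den i = a i *: num i + be.
  have -> : den i = a i *: num i + (num i * ('X - (a i)%:P) + (1 - w i) *: al).
    by rewrite /den -!mul_polyC; ring.
  by rewrite numE /be -!mul_polyC !polyCB; ring.
have monic_top (p : {poly L}) : (size p <= m.+2)%N -> p`_m.+1 = 1 ->
    p \is monic /\ size p = m.+2.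
  move=> sp p1; have s2 : size p = m.+2.
    apply/eqP; rewrite eqn_leq sp ltnNge; apply/negP => /(nth_default 0)/eqP.
    by rewrite p1 oner_eq0.
  by split=> //; rewrite monicE lead_coefE s2 p1.
have al1 : al`_m.+1 = 1 by have /monicP := alm; rewrite lead_coefE sal.
have [bem sbe] : be \is monic /\ size be = m.+2.
  apply: monic_top; last by rewrite coefB al1 [de`_ _]nth_default // subr0.
  by rewrite (leq_trans (size_polyD _ _)) // size_polyN geq_max sal leqnn leqW.
have dentop i : den i \is monic /\ size (den i) = m.+2.
  apply: monic_top.
    rewrite (leq_trans (size_polyD _ _)) // geq_max mulrC (leq_trans
      (size_polyMleq _ _)).
      by rewrite (leq_trans (size_scale_leq _ _)) // sal.
    by rewrite sn size_polyX addn2.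
  by rewrite coefD coefXM coefZ al1 numc mulr1 addrC subrK.
have c0 i : a i * (1 - w i) != 0 by rewrite mulf_neq0.
have alX : coprimep al 'X by rewrite coprimepX rootE.
have albe : coprimep al be.
  have -> : be = 1 * al + (-1) *: de by rewrite mul1r scaleN1r.
  by rewrite coprimep_addl_mul coprimepZr // oppr_eq0 oner_eq0.
have dvd_den p i : p %| den i -> p %| 'X * be - (a i * (1 - w i)) *: al.
  by rewrite -denE; apply: dvdp_mulr.
have alden i : coprimep al (den i).
  apply/coprimepP => p pal /dvd_den.
  rewrite dvdp_subl ?dvdpZr // => pXbe.
  have /coprimepP : coprimep al ('X * be) by rewrite coprimepMr alX.
  exact.
have beden i : coprimep be (den i).
  apply/coprimepP => p pbe /dvd_den.
  rewrite dvdp_subr ?dvdp_mull // dvdpZr // => pal.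
  by move/coprimepP: albe; apply.
have := @curve_degree K n B L phi w num den (fun=> m) (al * be) d k f Bu wP.
have -> : (\sum_(i < n.+1) m.+1 = (2 * m + 2) * m.+1)%N.
  by rewrite sum_nat_const card_ord ar1.
have -> : (size (al * be)%R).-1 = (2 * m + 2)%N.
  by rewrite size_monicM ?monic_neq0 // sal sbe ar4.
rewrite ar2 ar3.
apply=> //.
- by move=> i; have [] := dentop i.
- by move=> i; have [] := dentop i.
- by move=> i; rewrite sn.
(* Subtracting the identities for [i] and [j] cancels ['X * be] and leaves a nonzero multiple of
   [al]. *)
- move=> i j ij; apply/coprimepP => p /dvd_den pi /dvd_den pj.
  have pal : p %| al.
    have := dvdp_sub pi pj; rewrite opprD opprK addrACA subrr add0r addrC
      -scalerBl.
    by rewrite dvdpZr // subr_eq0 eq_sym wI.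
  move: pi; rewrite dvdp_subl ?dvdpZr // => pXbe.
  have /coprimepP : coprimep al ('X * be) by rewrite coprimepMr alX.
  exact.
- by rewrite monicMl.
- by move=> i; rewrite coprimepMl alden beden.
- move=> i; have [P PZ Pi] := Ze i.
  by apply: (curve_dvdp_vertex phi num den Bu Pi); apply: Zf.
have one0 : (const_mx 1 : 'rV[K]_n.+1) != 0.
  by apply/eqP => /rowP/(_ ord0)/eqP; rewrite !mxE oner_eq0.
have b_row0 : (\row_i b i : 'rV[K]_n.+1) != 0.
  by apply/eqP => /rowP/(_ ord0)/eqP; rewrite !mxE (negbTE (b0 _)).
rewrite exprMn Gauss_dvdp ?coprimep_expl ?coprimep_expr //; apply/andP; split.
  apply: (curve_dvdp (mu := 'X) (lam := 1) Bu Q1v one0 alX _ (Zf _ Q1Z)) => i.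
  rewrite mxE rmorph1 !mul1r /den opprD addrA subrr sub0r dvdpNr.
  by rewrite dvdpZr.
apply: (curve_dvdp (mu := 1) (lam := 1) Bu Qbv b_row0 (coprimep1 _) _
  (Zf _ QbZ)) => i.
have ab : phi (b i) * a i = 1 by rewrite -rmorphM mulfV // rmorph1.
rewrite mxE !mul1r den_be -mul_polyC mulrDr mulrA -polyCM ab mul1r opprD addrA.
by rewrite subrr sub0r dvdpNr mul_polyC dvdpZr // fmorph_eq0.
Qed.

Lemma symbolic_power_degree_odd k d f :
    (forall i, exists2 P, P \in Z & val P = <[delta_mx ord0 i *m B]>%VS) ->
    (exists2 P, P \in Z & val P = <[(const_mx 1 : 'rV_n.+1) *m B]>%VS) ->
    (exists2 P, P \in Z & val P = <[(\row_i b i) *m B]>%VS) ->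
    symbolic_power Z k f -> f \is d.-homog -> f != 0 ->
  ((m.+1 * (2 * m + 4)) * k <= (2 * m ^ 2 + 4 * m + 1) * d)%N.
Proof.
have [al [de [alm sal sde al0 [cad rel]]]] := generic_interpolation nm b0 b_inj.
have := @secant_curve _ (genericC K n) (@genericX K n) al de k d f.
move=> /(_ _ _ _ _ alm sal sde al0 cad rel); apply.
- exact: generic_mmap_neq0.
- exact: genericX_neq0.
- move=> i; rewrite -tofrac1 -tofracB; apply: (@tofrac_neq0 _ _ _ (fun=> 0)).
  by rewrite mevalB meval1 mevalXU subr0 oner_eq0.
move=> i j ij; rewrite -subr_eq0 -tofrac1 -!tofracB -!tofracM -tofracB.
apply: (@tofrac_neq0 _ _ _ (fun=> 0)).
rewrite mevalB !mevalM !mevalB meval1 !mevalXU !mevalC !subr0 !mulr1.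
by rewrite subr_eq0 (inj_eq invr_inj) (inj_eq b_inj).
Qed.

End SecantCurve.

(** * Coordinate frames *)

Section Frames.
Variables (K : fieldType) (n : nat).
Implicit Types (P : pspace K n) (Z : {fset pspace K n}) (B : 'M[K]_n.+1).

Definition point_rep P : 'rV[K]_n.+1 := vpick (val P).

Lemma point_repE P : val P = <[point_rep P]>%VS.
Proof.
have /eqP dP := valP P; apply/eqP;
  rewrite eq_sym eqEdim -memvE memv_pick dP dim_vline vpick0.
by rewrite -dimv_eq0 dP.
Qed.

Lemma point_rep_neq0 P : point_rep P != 0.
Proof. by have /eqP dP := valP P; rewrite vpick0 -dimv_eq0 dP. Qed.

Lemma pspan_annihilator Z (y : 'cV[K]_n.+1) :
  pspan Z = fullv -> (forall P, P \in Z -> point_rep P *m y = 0) -> y = 0.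
Proof.
move=> Zf Zy; pose ly := linfun (mulmxr y : 'rV[K]_n.+1 -> 'rV[K]_1).
have : (pspan Z <= lker ly)%VS.
  rewrite /pspan big_seq; apply: (big_ind (fun U => U <= lker ly)%VS).
  - exact: sub0v.
  - by move=> U V Ul Vl; rewrite subv_add Ul.
  by move=> P PZ; rewrite point_repE -memvE memv_ker lfunE /= Zy.
rewrite Zf => /subvP yk; apply/colP => i.
have /yk := memvf (delta_mx ord0 i : 'rV[K]_n.+1).
by rewrite memv_ker lfunE /= -rowE => /eqP/rowP/(_ ord0); rewrite !mxE.
Qed.

Lemma unitmx_annihilator B :
  (forall y : 'cV_n.+1, B *m y = 0 -> y = 0) -> B \in unitmx.
Proof.
move=> By; rewrite -unitmx_tr -row_free_unit -kermx_eq0;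
  apply/eqP/row_matrixP => i.
apply/trmx_inj; rewrite row0 trmx0; apply: By.
by apply/trmx_inj; rewrite trmx_mul trmxK trmx0 -row_mul mulmx_ker row0.
Qed.

(** The matrix of all representatives has full row space; a maximal set of independent rows is a
    frame with vertices in [Z]. *)
Lemma span_basis Z : pspan Z = fullv -> exists p B,
  [/\ B \in unitmx, injective p, forall i, p i \in Z
    & forall i : 'I_n.+1, val (p i) = <[(delta_mx ord0 i : 'rV_n.+1) *m B]>%VS].
Proof.
move=> Zf; pose s := in_tuple (enum_fset Z).
pose W := \matrix_i point_rep (tnth s i).
have Wf : row_full W.
  rewrite /row_full -mxrank_tr -/(row_free _) -kermx_eq0;
    apply/eqP/row_matrixP => i.
  apply/trmx_inj; rewrite row0 trmx0;
    apply: (pspan_annihilator Zf) => P /(tnthP s)[j ->].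
  rewrite -[point_rep _](rowK (fun j => point_rep (tnth s j))) -/W -row_mul.
  suff -> : W *m (row i (kermx W^T))^T = 0 by rewrite row0.
  by apply/trmx_inj; rewrite trmx_mul trmxK trmx0 -row_mul mulmx_ker row0.
exists (fun i => tnth s (fullrankfun Wf i)), (rowsub (fullrankfun Wf) W); split.
- exact: fullrowsub_unit.
- move=> i j; have x0 := tnth s (fullrankfun Wf i).
  rewrite !(tnth_nth x0) => /eqP; rewrite nth_uniq ?fset_uniq //.
  by move=> /eqP/val_inj/fullrankfun_inj.
- by move=> i; apply: mem_tnth.
by move=> i; rewrite point_repE -rowE row_rowsub rowK.
Qed.

Lemma vlineZ (c : K) (x : 'rV[K]_n.+1) : c != 0 -> <[c *: x]>%VS = <[x]>%VS.
Proof.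
move=> c0; apply/eqP; rewrite eqEsubv -!memvE memvZ ?memv_line //=.
by rewrite -[X in X \in _](scalerK c0) memvZ ?memv_line.
Qed.

Lemma frame_scale B (d : 'rV[K]_n.+1) : B \in unitmx ->
  (forall i, d ord0 i != 0) ->
  diag_mx d *m B \in unitmx /\ forall P i,
    val P = <[(delta_mx ord0 i : 'rV_n.+1) *m B]>%VS ->
    val P = <[(delta_mx ord0 i : 'rV_n.+1) *m (diag_mx d *m B)]>%VS.
Proof.
move=> Bu d0; split=> [|P i ->].
  by rewrite unitmx_mul Bu andbT unitmxE det_diag unitfE; apply/prodf_neq0.
have -> : (delta_mx ord0 i : 'rV_n.+1) *m (diag_mx d *m B) =
    d ord0 i *: ((delta_mx ord0 i : 'rV_n.+1) *m B).
  rewrite mulmxA scalemxAl; congr (_ *m _).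
  by rewrite -rowE; apply/rowP => j; rewrite !mxE eqxx [j == i]eq_sym mulr_natr.
by rewrite vlineZ.
Qed.

End Frames.

(** * Normal form of n + 3 points in general position *)

Section ThreeExtraPoints.
Variables (K : fieldType) (n : nat) (Z : {fset pspace K n}).
(* The vertices of the frame are indexed by [Some (Some i)], and the two
   remaining points by [Some None] and [None]. *)
Implicit Types z : option (option 'I_n.+1) -> pspace K n.
Hypothesis gen : linearly_general Z.

Lemma general_annihilator z (g : 'I_n.+1 -> option (option 'I_n.+1))
  (y : 'cV[K]_n.+1) :
    injective z -> (forall k, z k \in Z) -> injective g ->
  (forall i, point_rep (z (g i)) *m y = 0) -> y = 0.
Proof.
move=> zi zZ gi gy; pose T := [fset z (g i) | i in 'I_n.+1]%fset.
have cT : #|` T| = n.+1.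
  by rewrite card_imfset ?size_enum_ord //; apply: inj_comp.
have /eqP dT : \dim (pspan T) == n.+1.
  apply/eqP/gen => //; apply/fsubsetP => _ /imfsetP[i _ ->]; exact: zZ.
apply: (@pspan_annihilator _ _ T).
  by apply/eqP; rewrite eqEdim subvf dT dimvf /dim /= mul1n.
by move=> _ /imfsetP[i _ ->].
Qed.

Definition frame_coord (b : 'I_n.+1 -> K) (k : option
  (option 'I_n.+1)) : 'rV[K]_n.+1 :=
  match k with
  | Some (Some i) => delta_mx ord0 i
  | Some None => const_mx 1
  | None => \row_i b i
  end.

Lemma general_frame z : injective z -> (forall k, z k \in Z) -> exists B b,
  [/\ B \in unitmx, forall i, b i != 0, injective b
    & forall k, val (z k) = <[frame_coord b k *m B]>%VS].
Proof.
move=> zi zZ; pose B0 := \matrix_i point_rep (z (Some (Some i))).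
have B0u : B0 \in unitmx.
  apply: unitmx_annihilator => y B0y.
  apply: (general_annihilator (g := fun i => Some
    (Some i)) zi zZ) => [i j [] //|i].
  by rewrite -[point_rep _](rowK (fun i => point_rep (z (Some
    (Some i))))) -row_mul B0y row0.
have ann (g : 'I_n.+1 -> option (option 'I_n.+1)) (y : 'cV[K]_n.+1) :
  injective g ->
    (forall i, point_rep (z (g i)) *m invmx B0 *m y = 0) -> y = 0.
  move=> gi gy; have : invmx B0 *m y = 0.
    by apply: (general_annihilator zi zZ gi) => i; rewrite mulmxA.
  by move/(congr1 (mulmx B0)); rewrite mulKVmx // mulmx0.
have vert i : point_rep (z (Some (Some i))) *m invmx B0 = delta_mx ord0 i.
  rewrite -[point_rep _](rowK (fun i => point_rep (z (Some
    (Some i))))) -row_mul.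
  by rewrite mulmxV // row1.
have [x xE] : exists x, point_rep (z (Some None)) *m invmx B0 = x by eexists.
have [u uE] : exists u, point_rep (z None) *m invmx B0 = u by eexists.
have vert_delta i l : (delta_mx ord0 i :
  'rV[K]_n.+1) *m delta_mx l ord0 = ((i == l)%:R)%:M.
  by rewrite -rowE; apply/matrixP => s t; rewrite !ord1 !mxE !eqxx !andbT.
have row_delta (v : 'rV[K]_n.+1) l : v *m (delta_mx l ord0 :
  'cV_n.+1) = (v ord0 l)%:M.
  by rewrite -colE; apply/matrixP => s t; rewrite !ord1 !mxE eqxx.
have delta_neq0 l : (delta_mx l ord0 : 'cV[K]_n.+1) != 0.
  by apply/eqP => /colP/(_ l)/eqP; rewrite !mxE !eqxx oner_eq0.
have x0 l : x ord0 l != 0.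
  apply/eqP => xl; case/eqP: (delta_neq0 l).
  apply: (ann (fun i => if i == l then Some None else Some (Some i))).
    by move=> i j; case: eqP => [->|_]; case: eqP => [->|_] // [].
  move=> i; case: eqP => [_|/eqP/negbTE il];
    first by rewrite xE row_delta xl raddf0.
  by rewrite vert vert_delta il raddf0.
have u0 l : u ord0 l != 0.
  apply/eqP => ul; case/eqP: (delta_neq0 l).
  apply: (ann (fun i => if i == l then None else Some (Some i))).
    by move=> i j; case: eqP => [->|_]; case: eqP => [->|_] // [].
  move=> i; case: eqP => [_|/eqP/negbTE il];
    first by rewrite uE row_delta ul raddf0.
  by rewrite vert vert_delta il raddf0.
have [Bu Bvert] := frame_scale B0u x0.
exists (diag_mx x *m B0), (fun i => u ord0 i / x ord0 i); split=> //.
- by move=> i; rewrite mulf_neq0 ?invr_eq0.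
- move=> l l' ll'; apply/eqP/negPn/negP => nll'.
  have ux : u ord0 l * x ord0 l' = u ord0 l' * x ord0 l.
    by move/eqP: ll'; rewrite eqr_div // => /eqP.
  (* This linear form kills the vertices other than [l] and [l'], the first extra point by
     construction, and the second because the ratios agree. *)
  pose y : 'cV[K]_n.+1 := x ord0 l' *: delta_mx l ord0 - x ord0 l *:
    delta_mx l' ord0.
  have yE (v : 'rV[K]_n.+1) :
    v *m y = (x ord0 l' * v ord0 l - x ord0 l * v ord0 l')%:M.
    by rewrite mulmxBr -!scalemxAr !row_delta !scale_scalar_mx raddfB.
  have : y = 0.
    apply: (ann (fun i => if i == l then Some None else if i == l' then None
      else Some (Some i))) => [i j|i].
      by do !case: eqP => [->|_] //; case.
    case: eqP => [_|/eqP/negbTE il]; first by rewrite xE yE mulrC subrr raddf0.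
    case: eqP => [_|/eqP/negbTE il'];
      first by rewrite uE yE mulrC ux mulrC subrr raddf0.
    by rewrite vert yE !mxE /= ![_ == i]eq_sym il il' !mulr0 subrr raddf0.
  move/colP/(_ l)/eqP; rewrite !mxE !eqxx (negbTE nll') mulr1 mulr0 subr0.
  by rewrite (negbTE (x0 _)).
have diagE (v : 'rV[K]_n.+1) : v *m diag_mx x = \row_i (v ord0 i * x ord0 i).
  by rewrite mul_mx_diag; apply/rowP => i; rewrite !mxE.
case=> [[i|]|] /=.
- by apply: Bvert; rewrite point_repE -(mulmxKV B0u (point_rep _)) vert.
- rewrite point_repE mulmxA diagE -(mulmxKV B0u (point_rep _)) xE.
  by congr (<[_ *m _]>%VS); apply/rowP => i; rewrite !mxE mul1r.
rewrite point_repE mulmxA diagE -(mulmxKV B0u (point_rep _)) uE.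
by congr (<[_ *m _]>%VS); apply/rowP => i; rewrite !mxE divfK.
Qed.

Lemma general_form z t (k0 : option (option 'I_n.+1)) :
    injective z -> (forall k, z k \in Z) -> (t.+1 + t <= n.+1)%N ->
  exists f : {mpoly K[n.+1]}, [/\ f \is t.+1.-homog, f != 0
    & forall k, ideal_pow (vanishing_ideal [fset z k]%fset)
        (t + ((t.+1 + t <= n)%N && (k == k0))) f].
Proof.
move=> zi zZ tn.
(* Relabel so that [z k0] is the last vertex, which is a vertex of the cone as soon as
   [2 * t + 1 <= n]. *)
pose s := tperm k0 (Some (Some ord_max)).
have [B [b [Bu b0 bi zE]]] : exists B b,
  [/\ B \in unitmx, forall i, b i != 0, injective b
    & forall k, val (z (s k)) = <[frame_coord b k *m B]>%VS].
  by apply: (@general_frame (z \o s)) => [|k];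
    [exact: inj_comp zi perm_inj|exact: zZ].
exists (loewner B b tn); split;
  [exact: loewner_homog|exact: loewner_neq0|] => k.
have sk : s (s k) = k by rewrite /s tpermK.
have sk0 : (k == k0) = (s k == Some (Some ord_max)).
  by rewrite -[RHS](inj_eq (@perm_inj _ s)) sk /s tpermR.
have := zE (s k); rewrite sk sk0; case: (s k) => [[i|]|] /= zk.
- apply: ideal_powW (loewner_vertex b Bu tn zk); rewrite leq_add2l.
  by case: eqP => [[->]|_]; rewrite ?andbF ?andbT.
- by rewrite andbF addn0; exact: loewner_row zk.
by rewrite andbF addn0; exact: loewner_param zk.
Qed.

End ThreeExtraPoints.

(** * The Waldschmidt bound *)

Lemma count_mod_ge m c N : (c < m)%N -> (N %/ m <= \sum_(i < N)
  (i %% m == c))%N.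
Proof.
move=> cm; apply: leq_trans (leq_sum_widen (fun i => (i %% m == c)%N :
  nat) (leq_trunc_div N m)).
elim: (N %/ m)%N => // e IH; rewrite mulSnr big_split_ord /= -addn1 leq_add //.
rewrite (bigD1 (Ordinal cm)) //= modnMDl modn_small // eqxx.
exact: leq_addr.
Qed.

(** [N] counts the factors, of degree at most [m.+1]. With cone vertices running cyclically through
    [2 * m + 4] points, each point is missed at most [N - N %/ (2 * m + 4)] times. *)
Lemma odd_arith m k : (0 < m)%N -> (0 < k)%N -> exists N,
  (k + (N - N %/ (2 * m + 4)) <= m.+1 * N)%N /\
  ((2 * m ^ 2 + 4 * m + 1) * (N - N %/ (2 * m + 4)) <= (2 * m + 3) * (k.-1 +
    (2 * m + 1)))%N.
Proof.
move=> m0 k0; set r := (2 * m + 4)%N; have r0 : (0 < r)%N by rewrite /r; lia.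
have dle N : (N %/ r <= N)%N by exact: leq_div.
(* This is the first inequality rearranged; the smallest such [N] is taken. *)
have ex : exists N, (k <= m * N + N %/ r)%N by exists k;
  rewrite -[X in (X <= _)%N]mul1n; nia.
case: (ex_minnP ex) => N kN Nmin; exists N; split; first by have := dle N; nia.
have N0 : (0 < N)%N by rewrite lt0n; apply: contraTneq kN => ->;
  rewrite muln0 div0n; lia.
have kN' : (m * N.-1 + N.-1 %/ r < k)%N.
  by rewrite ltnNge; apply/negP => /Nmin; rewrite leqNgt prednK // leqnn.
have NE := divn_eq N.-1 r; have cr := ltn_pmod N.-1 r0.
move: (N.-1 %/ r)%N (N.-1 %% r)%N NE cr kN' => q c NE cr kN'.
have {NE} NE : N = (q * r + c.+1)%N by rewrite -(prednK N0) NE addnS.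
have kE : (m * (q * r + c) + q < k)%N by move: kN'; rewrite NE addnS /=.
have rE : r = (2 * m + 4)%N by [].
have qr : (q * r = (2 * m + 3) * q + q)%N by rewrite rE; lia.
(* Either [N %/ r] is still [q], and the claim reduces to [c <= 2 * m + 2], with equality possible;
   or it has just jumped to [q.+1]. *)
have [cr'|cr'] : (c.+1 < r)%N \/ c.+1 = r by lia.
  have -> : (N %/ r = q)%N by rewrite NE divnMDl // divn_small ?addn0.
  have -> : (N - q = (2 * m + 3) * q + c.+1)%N by rewrite NE qr; lia.
  have kb : (m * ((2 * m + 4) * q + c) + q <= k.-1)%N
    by rewrite [(_ * q)%N]mulnC -rE; lia.
  have cb : (m.+1 * c <= m.+1 * (2 * m + 2))%N by rewrite leq_mul2l /=; lia.
  apply: (@leq_trans ((2 * m + 3) * (m * ((2 * m + 4) * q + c) + q +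
    (2 * m + 1)))).
    by clear -cb; nia.
  by rewrite leq_mul2l leq_add2r kb orbT.
have -> : (N %/ r = q.+1)%N by rewrite NE cr' divnMDl // divnn r0 addn1.
have c3 : c = (2 * m + 3)%N by lia.
have -> : (N - q.+1 = (2 * m + 3) * q.+1)%N by rewrite NE cr' qr rE; lia.
have kb : (m * ((2 * m + 4) * q + (2 * m + 3)) + q <= k.-1)%N.
  by rewrite [(_ * q)%N]mulnC -rE -c3; lia.
rewrite mulnCA leq_mul2l; apply/orP; right.
apply: leq_trans (leq_add kb (leqnn _)).
by clear; nia.
Qed.

Section ExtraPoints.
Variables (K : fieldType) (n : nat) (Z : {fset pspace K n}).
Variable p : 'I_n.+1 -> pspace K n.
Hypotheses (p_inj : injective p) (pZ : forall i, p i \in Z).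

Definition extra_points : {fset pspace K n} :=
  (Z `\` [fset p i | i in 'I_n.+1])%fset.

Lemma card_extra_points : (#|` extra_points| + n.+1 = #|` Z|)%N.
Proof.
have sub : ([fset p i | i in 'I_n.+1] `<=` Z)%fset.
  by apply/fsubsetP => _ /imfsetP[i _ ->].
rewrite cardfsDS // card_imfset // size_enum_ord subnK //.
by have := fsubset_leq_card sub; rewrite card_imfset // size_enum_ord.
Qed.

Lemma extra_pointsP P : P \in Z -> P \in extra_points \/ exists i, P = p i.
Proof.
move=> PZ; rewrite inE PZ andbT; case: imfsetP => [[i _ ->]|]; last by left.
by right; exists i.
Qed.

End ExtraPoints.

Lemma waldschmidt_bound_subframe (R : realType) (K : fieldType) n
    (Z : {fset pspace K n}) B (S : {set 'I_n.+1}) :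
    (0 < n)%N -> B \in unitmx -> (0 < #|S|)%N ->
    (forall i, exists2 P, P \in Z & val P = <[delta_mx ord0 i *m B]>%VS) ->
    (exists2 P, P \in Z & val P = <[set_row K S *m B]>%VS) ->
    (forall P, P \in Z -> (exists i, val P = <[delta_mx ord0 i *m B]>%VS) \/
       val P = <[set_row K S *m B]>%VS) ->
  forall k, (0 < k)%N -> waldschmidt_bound R Z k.
Proof.
move=> n0 Bu S0 Zv Zr ZP;
  apply: (@waldschmidt_boundP K n R Z 2 (2 * n + 1 - #|S|)).
- by have := max_card S; rewrite card_ord; move: #|S| => s; lia.
- by move=> k d f; apply: (symbolic_power_degree_subframe Bu S0 Zv Zr).
by move=> k _; apply: (symbolic_power_subframe_form Bu S0 n0).
Qed.

(** Without an extra point, a singleton [S] makes [set_row] a vertex. With one, scaling the frame by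
    its nonzero coordinates turns it into the indicator of its support. *)
Lemma waldschmidt_bound_small (R : realType) (K : fieldType) n
    (Z : {fset pspace K n}) :
    (0 < n)%N -> (#|` Z| <= n + 2)%N -> pspan Z = fullv ->
  forall k, (0 < k)%N -> waldschmidt_bound R Z k.
Proof.
move=> n0 Zn /span_basis[p [B [Bu pi pZ pE]]].
have cE := card_extra_points pi pZ.
have [E0|E1] : #|` extra_points Z p| = 0%N \/ #|` extra_points Z p| = 1%N
  by lia.
  have rE : set_row K [set ord0] = delta_mx ord0 ord0 :> 'rV_n.+1.
    by apply/rowP => i; rewrite !mxE inE eqxx.
  apply: (@waldschmidt_bound_subframe R K n Z B [set ord0]) => //.
  - by rewrite cards1.
  - by move=> i; exists (p i).
  - by exists (p ord0); rewrite ?rE.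
  move=> P /(extra_pointsP p)[|[i ->]]; last by left; exists i.
  by move/cardfs0_eq: E0 => ->; rewrite inE.
have /cardfs1P[Q QE] : #|` extra_points Z p| == 1%N by rewrite E1.
have [x xE] : exists x, point_rep Q *m invmx B = x by eexists.
have x0 : x != 0.
  apply: contraNneq (point_rep_neq0 Q) => x0.
  by rewrite -(mulmxKV Bu (point_rep Q)) xE x0 mul0mx.
pose S := [set i | x ord0 i != 0].
pose d : 'rV[K]_n.+1 := \row_i if i \in S then x ord0 i else 1.
have [|Bu' vE] := frame_scale (d := d) Bu.
  by move=> i; rewrite mxE inE; case: ifP => // _; rewrite oner_eq0.
have Qx : val Q = <[set_row K S *m (diag_mx d *m B)]>%VS.
  rewrite point_repE -(mulmxKV Bu (point_rep Q)) xE mulmxA.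
  congr (<[_ *m _]>%VS); rewrite mul_mx_diag; apply/rowP => i; rewrite !mxE inE.
  by case: eqP => [->|_]; rewrite ?mul0r ?mul1r.
have QZ : Q \in Z.
  have : Q \in extra_points Z p by rewrite QE inE.
  by rewrite inE => /andP[].
apply: (@waldschmidt_bound_subframe R K n Z _ S n0 Bu') => //.
- apply/card_gt0P; have /rV0Pn[i xi] := x0.
  by exists i; rewrite inE.
- by move=> i; exists (p i) => //; apply: vE.
- by exists Q.
move=> P /(extra_pointsP p)[|[i ->]]; last by left; exists i; apply: vE.
by rewrite QE inE => /eqP ->; right.
Qed.

Section GeneralPosition.
Variables (R : realType) (K : fieldType) (n : nat) (Z : {fset pspace K n}).
Hypotheses (cZ : #|` Z| = (n + 3)%N) (gen : linearly_general Z).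
Hypothesis Zf : pspan Z = fullv.

Lemma general_enum : exists z : option (option 'I_n.+1) -> pspace K n,
  [/\ injective z, forall k, z k \in Z & forall P, P \in Z -> exists k, P
    = z k].
Proof.
have [p [B [Bu pi pZ pE]]] := span_basis Zf.
have cE := card_extra_points pi pZ.
have cE2 : #|` extra_points Z p| = 2%N by lia.
have [Q1 Q1E] : exists Q1, Q1 \in extra_points Z p.
  by apply/fset0Pn; rewrite -cardfs_gt0 cE2.
have /cardfs1P[Q2 QD] : #|` (extra_points Z p `\ Q1)%fset| == 1%N.
  by move: cE2; rewrite (cardfsD1 Q1) Q1E add1n => -[->].
have : Q2 \in (extra_points Z p `\ Q1)%fset by rewrite QD inE.
rewrite in_fsetD1 eq_sym => /andP[Q12 Q2E].
have QE P : P \in extra_points Z p -> P = Q1 \/ P = Q2.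
  move=> PE; have [->|PQ] := eqVneq P Q1; [by left|right].
  by apply/fset1P; rewrite -QD in_fsetD1 PQ.
have exZ Q : Q \in extra_points Z p -> Q \in Z by rewrite inE => /andP[].
have exN Q i : Q \in extra_points Z p -> p i != Q.
  rewrite inE => /andP[Qp _]; apply: contraNneq Qp => <-.
  by apply/imfsetP; exists i.
pose z k := match k with Some
  (Some i) => p i | Some None => Q1 | None => Q2 end.
exists z; split.
- have nQ1 i := negP (exN _ i Q1E); have nQ2 i := negP (exN _ i Q2E).
  case=> [[i|]|] [[j|]|] //= e.
  + by rewrite (pi _ _ e).
  + by case: (nQ1 i); rewrite e.
  + by case: (nQ2 i); rewrite e.
  + by case: (nQ1 j); rewrite e.
  + by rewrite e eqxx in Q12.
  + by case: (nQ2 j); rewrite e.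
  by rewrite e eqxx in Q12.
- by case=> [[i|]|] //=; apply: exZ.
move=> P /(extra_pointsP p)[|[i ->]]; last by exists (Some (Some i)).
by case/QE => ->; [exists (Some None)|exists None].
Qed.

Lemma waldschmidt_bound_even m : (0 < m)%N -> n = (2 * m)%N ->
  forall k, (0 < k)%N -> waldschmidt_bound R Z k.
Proof.
move=> m0 nm; have [z [zi zZ Zz]] := general_enum.
have [B [b [Bu b0 bi zE]]] := general_frame gen zi zZ.
have rT : set_row K [set: 'I_n.+1] = const_mx 1.
  by apply/rowP => i; rewrite !mxE inE.
apply: (@waldschmidt_boundP K n R Z 2 n) => [|k d f|k k0];
  first by rewrite nm; lia.
  (* For [S] full the curve is a rational normal curve of degree [n] through the generic point, the
     vertices and [const_mx 1]; these [n + 2] points of [Z] already give the bound. *)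
  have := @symbolic_power_degree_subframe K n B Z [set: 'I_n.+1] Bu _ k d f.
  rewrite cardsT card_ord rT (_ : 2 * n + 1 - n.+1 = n)%N; last by lia.
  apply=> // [i|]; first by exists (z (Some (Some i))) => //; rewrite zE.
  by exists (z (Some None)) => //; rewrite zE.
(* [k / m] rounded up. Each of the [e] factors loses one order at every point, so total degree
   [k + e] leaves order [k]. *)
pose e := ((k + m.-1) %/ m)%N.
have e1 : (e * m <= k + m.-1)%N by apply: leq_trunc_div.
have e2 : (k <= e * m)%N by have := ltn_ceil (k + m.-1) m0; rewrite -/e mulSn;
  lia.
have [N j Ne /andP[j0 jm]||f [fd f0 fP]] := @homog_assemble K n Z m.+1 e
  (fun _ _ => true) _ e (k + e)%N (leqnn _) _.
- have tn : (j.-1.+1 + j.-1 <= n.+1)%N by rewrite nm; lia.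
  have [f [fd f0 fP]] := general_form gen None zi zZ tn.
  exists f; rewrite prednK // in fd; split=> // P /Zz[l ->].
  by apply: ideal_powW (fP l); lia.
- by rewrite mulSn mulnC; lia.
exists e, f; split=> //; last by rewrite nm; lia.
move=> P /= PZ; apply: ideal_powW (fP P PZ).
by rewrite sum1_card card_ord addnK.
Qed.

Lemma waldschmidt_bound_odd m : (0 < m)%N -> n = (2 * m + 1)%N ->
  forall k, (0 < k)%N -> waldschmidt_bound R Z k.
Proof.
move=> m0 nm; have [z [zi zZ Zz]] := general_enum.
have [B [b [Bu b0 bi zE]]] := general_frame gen zi zZ.
apply: (@waldschmidt_boundP K n R Z (2 * m + 3) (2 * m ^ 2 + 4 * m + 1))
  => [|k d f If fd f0|k k0]; first by lia.
  have -> : (2 * m ^ 2 + 4 * m + 1 + (2 * m + 3) = m.+1 * (2 * m + 4))%N by lia.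
  apply: (symbolic_power_degree_odd nm Bu b0 bi _ _ _ If fd f0) => [i||].
  - by exists (z (Some (Some i))) => //; rewrite zE.
  - by exists (z (Some None)) => //; rewrite zE.
  by exists (z None) => //; rewrite zE.
have [N [kN eN]] := odd_arith m0 k0.
pose I3 := option (option 'I_n.+1); pose r := (2 * m + 4)%N.
have cI : #|{: I3}| = r by rewrite !card_option card_ord /r nm; lia.
(* Factor number [N] is a cone with vertex [z (c N)]; it loses one order at every other point and
   none at its vertex. *)
pose c N := nth None (enum {: I3}) (N %% r).
have [N' j NN /andP[j0 jm]|f [fd f0 fP]] := @homog_assemble K n Z m.+1 N
  (fun N P => P != z (c N)) _ N (k + (N - N %/ r))%N (leqnn _) kN.
  have tn : (j.-1.+1 + j.-1 <= n.+1)%N by rewrite nm; lia.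
  (* For odd [n] this holds up to [j = m.+1], so even the largest factor is a cone. *)
  have tn' : (j.-1.+1 + j.-1 <= n)%N by rewrite nm; lia.
  have [f [fd f0 fP]] := general_form gen (c N') zi zZ tn.
  exists f; rewrite prednK // in fd; split=> // P /Zz[l ->].
  apply: ideal_powW (fP l); rewrite tn' (inj_eq zi) /=.
  by case: (l == c N') => /=; lia.
exists (N - N %/ r)%N, f; split=> //; last by rewrite nm.
move=> P /= PZ; apply: ideal_powW (fP P PZ).
have [l ->] := Zz P PZ.
have lr : (index l (enum {: I3}) < r)%N by rewrite -cI cardE index_mem mem_enum.
suff : (\sum_(i < N) (z l != z (c i)) + N %/ r <= N)%N by lia.
apply: leq_trans (leq_add (leqnn _) (count_mod_ge N lr)) _.
rewrite -big_split /= -[X in (_ <= X)%N]card_ord -sum1_card;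
  apply: leq_sum => i _.
rewrite (inj_eq zi); case: (_ %% _ =P _)%N => [il|_]; last by case: (_ == _).
by rewrite /c il nth_index ?mem_enum // eqxx.
Qed.

End GeneralPosition.

Theorem corollary5p7 (R : realType) (K : fieldType) (n : nat)
    (Z : {fset pspace K n})
    (hn : (2 <= n)%N)
    (hcard : (#|` Z| <= n + 3)%N)
    (hspan : pspan Z = fullv)
    (hgen : #|` Z| = (n + 3)%N -> linearly_general Z) :
  (~ (#|` Z| = (n + 3)%N /\ odd n) ->
     forall k : nat, (1 <= k)%N -> waldschmidt_bound R Z k) /\
  (#|` Z| = (n + 3)%N /\ odd n ->
     forall k : nat, (1 <= k)%N ->
       (n%:R ^+ 2 + n%:R + 1) * (n%:R ^+ 2 + 2 * n%:R - 1) / (2 * (n%:R + 2))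
         <= k%:R :> R ->
       waldschmidt_bound R Z k).
Proof.
split=> [no k k1|[cZ on] k k1 _]; last first.
  apply: (waldschmidt_bound_odd (m := n./2) R cZ (hgen cZ) hspan) => //;
    first by lia.
  by rewrite -[LHS]odd_double_half on addnC mul2n.
have [cZ|cZ] := leqP #|` Z| (n + 2).
  by apply: waldschmidt_bound_small => //; apply: ltnW.
have {}cZ : #|` Z| = (n + 3)%N by lia.
have on : ~~ odd n by apply/negP => on; apply: no.
apply: (waldschmidt_bound_even (m := n./2) R cZ (hgen cZ) hspan) => //;
  first by lia.
by rewrite -[LHS]odd_double_half (negbTE on) mul2n.
Qed.
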